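(* Let $r,s,r',s'\in\mathbb{C}^*$ with $r^{d_i}\neq s^{d_i}$ and $r'^{d_i}\neq s'^{d_i}$ for all $i\in I$, and let $U^+_{r,s}$ and $U^+_{r',s'}$ be the positive parts (over $\mathbb{C}$) of the two-parameter quantum groups $U_{r,s}(\mathfrak g)$ and $U_{r',s'}(\mathfrak g)$. If $rs^{-1}=r's'^{-1}$ or $rs^{-1}=r'^{-1}s'$, then $U^+_{r,s}$ and $U^+_{r',s'}$ are $2$-cocycle deformations of each other as $Q^+$-graded associative $\mathbb{C}$-algebras. That is, there are $2$-cocycles $\psi,\psi':Q\times Q\to\mathbb{C}^*$ such that $(U^+_{r,s})^{\psi}\cong U^+_{r',s'}$ and $(U^+_{r',s'})^{\psi'}\cong U^+_{r,s}$ as $Q^+$-graded associative $\mathbb{C}$-algebras.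
   Context: Let $C=(a_{ij})_{i,j\in I}$, $I=\{1,\dots,n\}$, be a Cartan matrix of finite type, $\mathfrak g$ the associated semisimple Lie algebra, and $\{d_i\mid i\in I\}$ relatively prime positive integers with $d_ia_{ij}=d_ja_{ji}$. Let $Q=\bigoplus_{i\in I}\mathbb{Z}\alpha_i$ be the root lattice and $Q^+=\bigoplus_{i\in I}\mathbb{Z}_{\ge 0}\alpha_i$. The Euler form is the (generally non-symmetric) bilinear form on $Q$ with $\langle i,j\rangle:=\langle\alpha_i,\alpha_j\rangle=d_ia_{ij}$ if $i<j$, $=d_i$ if $i=j$, and $=0$ if $i>j$. For $r,s\in\mathbb{C}^*$ put $r_i=r^{d_i}$, $s_i=s^{d_i}$, and assume $r_i\ne s_i$. The algebra $U_{r,s}(\mathfrak g)$ over $\mathbb{C}$ is the unital associative algebra generated by $e_i,f_i,\omega_i^{\pm1},\omega_i'^{\pm1}$ ($i\in I$) with relations: (R1) all $\omega_i^{\pm1},\omega_j'^{\pm1}$ commute with one another and $\omega_i\omega_i^{-1}=\omega_i'\omega_i'^{-1}=1$; (R2) $\omega_ie_j\omega_i^{-1}=r^{\langle j,i\rangle}s^{-\langle i,j\rangle}e_j$, $\ \omega_i'e_j\omega_i'^{-1}=r^{-\langle i,j\rangle}s^{\langle j,i\rangle}e_j$; (R3) $\omega_if_j\omega_i^{-1}=r^{-\langle j,i\rangle}s^{\langle i,j\rangle}f_j$, $\ \omega_i'f_j\omega_i'^{-1}=r^{\langle i,j\rangle}s^{-\langle j,i\rangle}f_j$; (R4) $e_if_j-f_je_i=\delta_{i,j}\dfrac{\omega_i-\omega_i'}{r_i-s_i}$;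 (R5) for $i\ne j$: $\sum_{k=0}^{1-a_{ij}}(-1)^k\binom{1-a_{ij}}{k}_{r_is_i^{-1}}c_{ij}^{(k)}\,e_i^{1-a_{ij}-k}e_je_i^k=0$; (R6) for $i\ne j$: $\sum_{k=0}^{1-a_{ij}}(-1)^k\binom{1-a_{ij}}{k}_{r_is_i^{-1}}c_{ij}^{(k)}\,f_i^{k}f_jf_i^{1-a_{ij}-k}=0$; where $c_{ij}^{(k)}=(r_is_i^{-1})^{k(k-1)/2}r^{k\langle j,i\rangle}s^{-k\langle i,j\rangle}$. Here $(n)_v=\frac{v^n-1}{v-1}$, $(n)_v!=(1)_v\cdots(n)_v$, $(0)_v!=1$, and $\binom{n}{k}_v=\frac{(n)_v!}{(k)_v!(n-k)_v!}$ (a polynomial in $v$, evaluated at the indicated value). $U^+_{r,s}$ is the subalgebra generated by the $e_i$ ($i\in I$). It is $Q^+$-graded (hence $Q$-graded) with $e_i$ of degree $\alpha_i$. Cocycle deformation: if $G$ is an abelian group, $A=\bigoplus_{g\in G}A_g$ a $G$-graded associative algebra over a field $k$, and $\psi:G\times G\to k^*$ a $2$-cocycle of $G$, then $A^\psi$ is the same graded vector space with the new multiplication $x*y=\psi(g,h)\,xy$ for $x\in A_g$, $y\in A_h$. It is again a $G$-graded associative algebra, called the cocycle deformation of $A$ by $\psi$. *)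

(* Defs.v *)
From HB Require Import structures.
From mathcomp Require Import all_boot all_order all_algebra finmap.
From mathcomp Require Import monalg.
From mathcomp Require Import boolp reals.
From mathcomp Require Import complex.

Set Implicit Arguments.
Unset Strict Implicit.
Unset Printing Implicit Defensive.

Import Order.TTheory GRing.Theory Num.Theory.
Local Open Scope ring_scope.

Section Grading.
Variables (K : fieldType) (G : zmodType).

(* [gcomp g] is the homogeneous component A_g; the last two fields say that
   A is the direct sum of the A_g. *)
Record grading (A : algType K) := Grading {
  gcomp :> G -> {pred A};
  gcomp_submod : forall g, submod_closed (gcomp g);
  gcomp1 : 1 \in gcomp 0;
  gcompM : forall g h x y,
    x \in gcomp g -> y \in gcomp h -> x * y \in gcomp (g + h);
  gcomp_sum : forall x, exists2 f : {fsfun G -> A with 0},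
    forall g, f g \in gcomp g & x = \sum_(g <- finsupp f) f g;
  gcomp_direct : forall f : {fsfun G -> A with 0},
    (forall g, f g \in gcomp g) -> \sum_(g <- finsupp f) f g = 0 ->
    forall g, f g = 0
}.

Definition graded_iso (A B : algType K) (grA : grading A) (grB : grading B) :=
  exists2 phi : {lrmorphism A -> B}, bijective phi &
    forall g x, (phi x \in grB g) = (x \in grA g).

(* No normalization psi 0 0 = 1 is required. *)
Record cocycle := Cocycle {
  cocycle_fun :> G -> G -> K;
  cocycle_neq0 : forall g h, cocycle_fun g h != 0;
  cocycleP : forall g h k,
    cocycle_fun g h * cocycle_fun (g + h) k =
    cocycle_fun g (h + k) * cocycle_fun h k
}.

End Grading.

Section GradingTheory.
Variables (K : fieldType) (G : zmodType) (A : algType K) (gr : grading G A).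
Implicit Types (x y z : A) (g h k : G).

Definition gdec x : {fsfun G -> A with 0} := s2val (cid2 (gcomp_sum gr x)).

Lemma gdec_in x g : gdec x g \in gr g.
Proof. exact: (s2valP (cid2 (gcomp_sum gr x))). Qed.

Lemma gdec_sum x : x = \sum_(g <- finsupp (gdec x)) gdec x g.
Proof. exact: (s2valP' (cid2 (gcomp_sum gr x))). Qed.

Lemma gcomp0 g : 0 \in gr g.
Proof. by case: (gcomp_submod gr g). Qed.

Lemma gcomp_lin g c x y : x \in gr g -> y \in gr g -> c *: x + y \in gr g.
Proof. by move=> xg yg; case: (gcomp_submod gr g) => _; apply. Qed.

Lemma gcompZ g c x : x \in gr g -> c *: x \in gr g.
Proof. by move=> xg; rewrite -[_ *: _]addr0 gcomp_lin ?gcomp0. Qed.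

Lemma gsum_widen (f : {fsfun G -> A with 0}) (S : {fset G}) :
  (finsupp f `<=` S)%fset -> \sum_(g <- finsupp f) f g = \sum_(g <- S) f g.
Proof. by move=> fS; apply: big_fset_incl => // g _; apply: fsfun_dflt. Qed.

Lemma gdec_uniq (S : {fset G}) (F : G -> A) :
  (forall g, F g \in gr g) -> forall g,
  gdec (\sum_(g <- S) F g) g = if g \in S then F g else 0.
Proof.
move=> Fg g; set x := \sum_(_ <- _) _.
pose T := (finsupp (gdec x) `|` S)%fset.
pose f : {fsfun G -> A with 0} :=
  [fsfun g in T => gdec x g - (if g \in S then F g else 0)].
have fE h : f h = gdec x h - (if h \in S then F h else 0).
  rewrite fsfun_fun; case: ifPn => //.
  rewrite in_fsetU negb_or => /andP[hx /negbTE ->].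
  by rewrite fsfun_dflt // subrr.
apply/eqP; rewrite -subr_eq0 -fE; apply/eqP.
apply: (@gcomp_direct K G A gr) => [h|].
  rewrite fE addrC -scaleN1r gcomp_lin ?gdec_in //.
  by case: ifP => _; rewrite ?gcomp0.
rewrite (@gsum_widen _ T); last first.
  by apply/fsubsetP => h; rewrite mem_finsupp fsfun_fun; case: ifP => //; rewrite eqxx.
under eq_bigr => h _ do rewrite fE.
rewrite sumrB -(@gsum_widen _ T) ?fsubsetUl // -gdec_sum.
rewrite -(big_fset_incl _ (fsubsetUr (finsupp (gdec x)) S)) /=; last first.
  by move=> h _ /negbTE ->.
have -> : \sum_(h <- S) (if h \in S then F h else 0) = x.
  by rewrite [RHS]big_seq [LHS]big_seq; apply: eq_bigr => h ->.
exact: subrr.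
Qed.

Lemma gdecE (f : {fsfun G -> A with 0}) g :
  (forall h, f h \in gr h) -> gdec (\sum_(h <- finsupp f) f h) g = f g.
Proof.
move=> fg; rewrite gdec_uniq //; case: ifPn => // gf.
by rewrite fsfun_dflt.
Qed.

Lemma gdec_lin c x y g : gdec (c *: x + y) g = c *: gdec x g + gdec y g.
Proof.
pose T := (finsupp (gdec x) `|` finsupp (gdec y))%fset.
rewrite {1}[x]gdec_sum {1}[y]gdec_sum.
rewrite (@gsum_widen _ T) ?fsubsetUl // (@gsum_widen (gdec y) T) ?fsubsetUr //.
rewrite scaler_sumr -big_split /= gdec_uniq; last first.
  by move=> h; rewrite gcomp_lin ?gdec_in.
case: ifPn => //; rewrite in_fsetU negb_or => /andP[gx gy].
by rewrite !fsfun_dflt // scaler0 addr0.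
Qed.

Lemma gdec_homog g x h : x \in gr g -> gdec x h = if h == g then x else 0.
Proof.
move=> xg; have -> : x = \sum_(k <- [fset g]%fset) (if k == g then x else 0).
  by rewrite big_seq_fset1 eqxx.
rewrite gdec_uniq ?in_fset1 ?big_seq_fset1 ?eqxx; last first.
  by move=> k; case: eqP => [->|]; rewrite ?gcomp0.
by case: eqP.
Qed.

End GradingTheory.

(* A^psi; the grading is an argument since the new product depends on it. *)
Definition twist (K : fieldType) (G : zmodType) (A : algType K)
  (gr : grading G A) (psi : cocycle K G) : Type := A.

Section Twist.
Variables (K : fieldType) (G : zmodType) (A : algType K).
Variables (gr : grading G A) (psi : cocycle K G).
Implicit Types (x y z : A) (g h k : G).

Definition twist_mul x y : A :=
  \sum_(g <- finsupp (gdec gr x)) \sum_(h <- finsupp (gdec gr y))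
    psi g h *: (gdec gr x g * gdec gr y h).

Definition twist_one : A := (psi 0 0)^-1 *: 1.

Lemma twist_mulEw (S T : {fset G}) x y :
  (finsupp (gdec gr x) `<=` S)%fset -> (finsupp (gdec gr y) `<=` T)%fset ->
  twist_mul x y =
  \sum_(g <- S) \sum_(h <- T) psi g h *: (gdec gr x g * gdec gr y h).
Proof.
move=> xS yT; rewrite /twist_mul (big_fset_incl _ xS) /=; last first.
  by move=> g _ gx; apply: big1 => h _; rewrite fsfun_dflt // mul0r scaler0.
apply: eq_bigr => g _; apply: big_fset_incl => // h _ hy.
by rewrite (fsfun_dflt hy) mulr0 scaler0.
Qed.

Lemma twist_mul_linl c x y z :
  twist_mul (c *: x + y) z = c *: twist_mul x z + twist_mul y z.
Proof.
pose D u := finsupp (gdec gr u).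
pose S := (D (c *: x + y)%R `|` (D x `|` D y))%fset.
rewrite (@twist_mulEw S (D z)) ?fsubsetUl // (@twist_mulEw S (D z) x) //; last first.
  exact: fsubset_trans (fsubsetUl _ _) (fsubsetUr _ _).
rewrite (@twist_mulEw S (D z) y) //; last first.
  exact: fsubset_trans (fsubsetUr _ _) (fsubsetUr _ _).
rewrite scaler_sumr -big_split /=; apply: eq_bigr => g _.
rewrite scaler_sumr -big_split /=; apply: eq_bigr => h _.
by rewrite gdec_lin mulrDl scalerDr -scalerAl !scalerA mulrC.
Qed.

Lemma twist_mul_linr c x y z :
  twist_mul z (c *: x + y) = c *: twist_mul z x + twist_mul z y.
Proof.
pose D u := finsupp (gdec gr u).
pose S := (D (c *: x + y)%R `|` (D x `|` D y))%fset.
rewrite (@twist_mulEw (D z) S) ?fsubsetUl // (@twist_mulEw (D z) S z x) //; last first.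
  exact: fsubset_trans (fsubsetUl _ _) (fsubsetUr _ _).
rewrite (@twist_mulEw (D z) S z y) //; last first.
  exact: fsubset_trans (fsubsetUr _ _) (fsubsetUr _ _).
rewrite scaler_sumr -big_split /=; apply: eq_bigr => g _.
rewrite scaler_sumr -big_split /=; apply: eq_bigr => h _.
by rewrite gdec_lin mulrDr scalerDr -scalerAr !scalerA mulrC.
Qed.

Lemma twist_mul0x x : twist_mul 0 x = 0.
Proof.
have := twist_mul_linl (-1) x x x.
by rewrite scaleN1r addNr scaleN1r addNr.
Qed.

Lemma twist_mulx0 x : twist_mul x 0 = 0.
Proof.
have := twist_mul_linr (-1) x x x.
by rewrite scaleN1r addNr scaleN1r addNr.
Qed.

Lemma twist_mulDl : left_distributive twist_mul +%R.
Proof. by move=> x y z; rewrite -{1}[x]scale1r twist_mul_linl scale1r. Qed.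

Lemma twist_mulDr : right_distributive twist_mul +%R.
Proof. by move=> x y z; rewrite -{1}[y]scale1r twist_mul_linr scale1r. Qed.

Lemma twist_mulZl c x y : twist_mul (c *: x) y = c *: twist_mul x y.
Proof. by rewrite -[c *: x]addr0 twist_mul_linl twist_mul0x addr0. Qed.

Lemma twist_mulZr c x y : twist_mul x (c *: y) = c *: twist_mul x y.
Proof. by rewrite -[c *: y]addr0 twist_mul_linr twist_mulx0 addr0. Qed.

Lemma twist_mul_homog g h x y : x \in gr g -> y \in gr h ->
  twist_mul x y = psi g h *: (x * y).
Proof.
move=> xg yh; rewrite (@twist_mulEw [fset g]%fset [fset h]%fset).
- by rewrite !big_seq_fset1 !(gdec_homog _ xg, gdec_homog _ yh) !eqxx.
- apply/fsubsetP => k; rewrite mem_finsupp in_fset1 (gdec_homog _ xg).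
  by case: (k == g); rewrite ?eqxx.
- apply/fsubsetP => k; rewrite mem_finsupp in_fset1 (gdec_homog _ yh).
  by case: (k == h); rewrite ?eqxx.
Qed.

Lemma gr_ind (P : A -> Prop) :
  P 0 -> (forall x y, P x -> P y -> P (x + y)) ->
  (forall g x, x \in gr g -> P x) -> forall x, P x.
Proof.
move=> P0 PD Pg x; rewrite [x](gdec_sum gr).
by elim/big_ind: _ => // g _; apply: Pg (gdec_in gr x g).
Qed.

Lemma twist_mulA : associative twist_mul.
Proof.
move=> x y z; elim/gr_ind: x => [|x x' IH IH'|g x xg].
- by rewrite !twist_mul0x.
- by rewrite !twist_mulDl IH IH'.
elim/gr_ind: y => [|y y' IH IH'|h y yh].
- by rewrite !(twist_mulx0, twist_mul0x).
- by rewrite !(twist_mulDl, twist_mulDr) IH IH'.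
elim/gr_ind: z => [|z z' IH IH'|k z zk].
- by rewrite !twist_mulx0.
- by rewrite !twist_mulDr IH IH'.
rewrite (twist_mul_homog yh zk) (twist_mul_homog xg yh) twist_mulZr twist_mulZl.
rewrite (twist_mul_homog xg (gcompM yh zk)) (twist_mul_homog (gcompM xg yh) zk).
by rewrite !scalerA mulrA cocycleP [psi g _ * _]mulrC.
Qed.

Lemma cocycle0l h : psi 0 h = psi 0 0.
Proof.
have := cocycleP psi 0 0 h; rewrite !add0r => /(mulIf (cocycle_neq0 psi 0 h)).
by move=> ->.
Qed.

Lemma cocycle0r h : psi h 0 = psi 0 0.
Proof.
have := cocycleP psi h 0 0; rewrite !addr0 => /(mulfI (cocycle_neq0 psi h 0)).
by move=> ->.
Qed.

Lemma twist_mul1x : left_id twist_one twist_mul.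
Proof.
move=> x; elim/gr_ind: x => [|x x' IH IH'|g x xg].
- by rewrite twist_mulx0.
- by rewrite twist_mulDr IH IH'.
rewrite twist_mulZl (twist_mul_homog (gcomp1 gr) xg) mul1r cocycle0l.
by rewrite scalerA mulVf ?cocycle_neq0 // scale1r.
Qed.

Lemma twist_mulx1 : right_id twist_one twist_mul.
Proof.
move=> x; elim/gr_ind: x => [|x x' IH IH'|g x xg].
- by rewrite twist_mul0x.
- by rewrite twist_mulDl IH IH'.
rewrite twist_mulZr (twist_mul_homog xg (gcomp1 gr)) mulr1 cocycle0r.
by rewrite scalerA mulVf ?cocycle_neq0 // scale1r.
Qed.

Lemma twist_one_neq0 : twist_one != 0.
Proof. by rewrite scaler_eq0 oner_eq0 invr_eq0 (negPf (cocycle_neq0 _ _ _)). Qed.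

HB.instance Definition _ := GRing.Lmodule.on (twist gr psi).
HB.instance Definition _ := GRing.Zmodule_isNzRing.Build (twist gr psi)
  twist_mulA twist_mul1x twist_mulx1 twist_mulDl twist_mulDr twist_one_neq0.
HB.instance Definition _ := GRing.Lmodule_isLalgebra.Build K (twist gr psi)
  (fun c x y => esym (twist_mulZl c x y)).
HB.instance Definition _ := GRing.Lalgebra_isAlgebra.Build K (twist gr psi)
  (fun c x y => esym (twist_mulZr c x y)).

Lemma twist_gcomp1 : (1 : twist gr psi) \in gr 0.
Proof. exact: gcompZ (gcomp1 gr). Qed.

Lemma twist_gcompM g h (x y : twist gr psi) :
  x \in gr g -> y \in gr h -> x * y \in gr (g + h).
Proof.
move=> xg yh; rewrite [x * y](twist_mul_homog xg yh).
exact: gcompZ (gcompM xg yh).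
Qed.

Definition twist_grading : grading G (twist gr psi) :=
  @Grading K G (twist gr psi) gr (gcomp_submod gr) twist_gcomp1 twist_gcompM
    (gcomp_sum gr) (@gcomp_direct K G A gr).

End Twist.

Definition two_sided_ideal (A : nzRingType) (J : {pred A}) :=
  zmod_closed J /\
  forall a x, x \in J -> a * x \in J /\ x * a \in J.

HB.mixin Record isProperTwoSided (A : nzRingType) (J : A -> bool) := {
  two_sided_mull : forall a x, x \in (J : {pred A}) -> a * x \in (J : {pred A});
  two_sided_mulr : forall a x, x \in (J : {pred A}) -> x * a \in (J : {pred A});
  two_sided_proper : 1 \notin (J : {pred A})
}.

#[short(type="properTwoSided")]
HB.structure Definition ProperTwoSided (A : nzRingType) :=
  {J of GRing.ZmodClosed A J & isProperTwoSided A J}.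

Section QuotientAlgebra.
Variables (K : fieldType) (A : algType K) (J : properTwoSided A).
Local Open Scope quotient_scope.

Definition quot_alg : Type := Quotient.quot J.
HB.instance Definition _ := Choice.on quot_alg.
HB.instance Definition _ := GRing.Zmodule.on quot_alg.

Definition quot_pi (x : A) : quot_alg := \pi_(Quotient.quot J) x.
Definition quot_repr (x : quot_alg) : A := repr (x : Quotient.quot J).

Lemma quot_reprK x : quot_pi (quot_repr x) = x.
Proof. exact: (@reprK A (Quotient.quot J)). Qed.

Lemma quot_piP x y : quot_pi x = quot_pi y <-> x - y \in J.
Proof.
rewrite Quotient.idealrBE; exact: (rwP eqP).
Qed.

Lemma quot_piB x y : quot_pi (x - y) = quot_pi x - quot_pi y.
Proof. exact: (raddfB (\pi_(Quotient.quot J))). Qed.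

Lemma quot_piD x y : quot_pi (x + y) = quot_pi x + quot_pi y.
Proof. exact: (raddfD (\pi_(Quotient.quot J))). Qed.

Definition quot_one : quot_alg := quot_pi 1.
Definition quot_mul (x y : quot_alg) : quot_alg :=
  quot_pi (quot_repr x * quot_repr y).
Definition quot_scale (c : K) (x : quot_alg) : quot_alg :=
  quot_pi (c *: quot_repr x).

Lemma quot_piM x y : quot_pi (x * y) = quot_mul (quot_pi x) (quot_pi y).
Proof.
apply/quot_piP; set x' := quot_repr _; set y' := quot_repr _.
have xx' : x - x' \in J by apply/quot_piP; rewrite quot_reprK.
have yy' : y - y' \in J by apply/quot_piP; rewrite quot_reprK.
have -> : x * y - x' * y' = (x - x') * y + x' * (y - y').
  by rewrite mulrBl mulrBr addrA subrK.
apply: rpredD; [exact: two_sided_mulr xx'|exact: two_sided_mull yy'].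
Qed.

Lemma quot_piZ c x : quot_pi (c *: x) = quot_scale c (quot_pi x).
Proof.
apply/quot_piP; set x' := quot_repr _.
have xx' : x - x' \in J by apply/quot_piP; rewrite quot_reprK.
by rewrite -scalerBr -[x - x']mul1r scalerAl two_sided_mull.
Qed.

Lemma quot_mulA : associative quot_mul.
Proof.
move=> x y z; rewrite -[x]quot_reprK -[y]quot_reprK -[z]quot_reprK.
by rewrite -!quot_piM mulrA.
Qed.

Lemma quot_mul1x : left_id quot_one quot_mul.
Proof. by move=> x; rewrite -[x]quot_reprK -quot_piM mul1r. Qed.

Lemma quot_mulx1 : right_id quot_one quot_mul.
Proof. by move=> x; rewrite -[x]quot_reprK -quot_piM mulr1. Qed.

Lemma quot_mulDl : left_distributive quot_mul +%R.
Proof.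
move=> x y z; rewrite -[x]quot_reprK -[y]quot_reprK -[z]quot_reprK.
by rewrite -quot_piD -!quot_piM -quot_piD mulrDl.
Qed.

Lemma quot_mulDr : right_distributive quot_mul +%R.
Proof.
move=> x y z; rewrite -[x]quot_reprK -[y]quot_reprK -[z]quot_reprK.
by rewrite -quot_piD -!quot_piM -quot_piD mulrDr.
Qed.

Lemma quot_one_neq0 : quot_one != 0.
Proof.
apply/eqP => /esym h; have := two_sided_proper (s := J).
suff -> : 1 \in J by [].
rewrite -[1]subr0; apply/quot_piP.
by rewrite -/quot_one -h -(subrr (1 : A)) quot_piB subrr.
Qed.

HB.instance Definition _ := GRing.Zmodule_isNzRing.Build quot_alg
  quot_mulA quot_mul1x quot_mulx1 quot_mulDl quot_mulDr quot_one_neq0.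

Lemma quot_scaleA a b x : quot_scale a (quot_scale b x) = quot_scale (a * b) x.
Proof. by rewrite -[x]quot_reprK -!quot_piZ scalerA. Qed.

Lemma quot_scale1 : left_id 1 quot_scale.
Proof. by move=> x; rewrite -[x]quot_reprK -quot_piZ scale1r. Qed.

Lemma quot_scaleDr : right_distributive quot_scale +%R.
Proof.
move=> c x y; rewrite -[x]quot_reprK -[y]quot_reprK.
by rewrite -quot_piD -!quot_piZ -quot_piD scalerDr.
Qed.

Lemma quot_scaleDl x : {morph quot_scale^~ x : a b / a + b}.
Proof.
by move=> a b; rewrite -[x]quot_reprK -!quot_piZ -quot_piD scalerDl.
Qed.

HB.instance Definition _ := GRing.Zmodule_isLmodule.Build K quot_alg
  quot_scaleA quot_scale1 quot_scaleDr quot_scaleDl.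

Lemma quot_scaleAl c (x y : quot_alg) : c *: (x * y) = (c *: x) * y.
Proof.
rewrite -[x]quot_reprK -[y]quot_reprK.
by rewrite /GRing.scale /GRing.mul /= -!(quot_piM, quot_piZ) scalerAl.
Qed.

Lemma quot_scaleAr c (x y : quot_alg) : c *: (x * y) = x * (c *: y).
Proof.
rewrite -[x]quot_reprK -[y]quot_reprK.
by rewrite /GRing.scale /GRing.mul /= -!(quot_piM, quot_piZ) scalerAr.
Qed.

HB.instance Definition _ := GRing.Lmodule_isLalgebra.Build K quot_alg quot_scaleAl.
HB.instance Definition _ := GRing.Lalgebra_isAlgebra.Build K quot_alg quot_scaleAr.

HB.instance Definition _ := GRing.isZmodMorphism.Build A quot_alg quot_pi quot_piB.
HB.instance Definition _ := GRing.isMonoidMorphism.Build A quot_alg quot_pi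
  (conj (erefl _) quot_piM).
HB.instance Definition _ := GRing.isScalable.Build K A quot_alg *:%R quot_pi quot_piZ.

End QuotientAlgebra.

(* The free associative algebra on X: the monoid algebra of the words on X. *)
Definition free_alg (K : fieldType) (X : choiceType) := {malg K[{fmonom X}]}.

Section FreeAlgebra.
Variables (K : fieldType) (X : choiceType).
Local Notation F := (free_alg K X).

HB.instance Definition _ := GRing.Lalgebra.on F.

Lemma free_scalerAr (c : K) (p q : F) : c *: (p * q) = p * (c *: q).
Proof.
have Cc (u : F) : u * c%:MP = c *: u.
  rewrite -mul_malgC [LHS]fgmulgU [RHS]fgmulUg.
  by apply: eq_bigr => m _; rewrite mulrC mulm1 mul1m.
by rewrite -[LHS]Cc -mulrA Cc.
Qed.

HB.instance Definition _ := GRing.Lalgebra_isAlgebra.Build K F free_scalerAr.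

Definition fgen (x : X) : F := << fmu x >>.

Definition ideal_gen (rel : F -> F -> Prop) : {pred F} := fun p =>
  `[< forall J : {pred F}, two_sided_ideal J ->
      (forall q q', rel q q' -> q - q' \in J) -> p \in J >].

Lemma ideal_genP rel p :
  reflect (forall J : {pred F}, two_sided_ideal J ->
    (forall q q', rel q q' -> q - q' \in J) -> p \in J) (p \in ideal_gen rel).
Proof. exact: asboolP. Qed.

Lemma ideal_gen_two_sided rel : two_sided_ideal (ideal_gen rel).
Proof.
split; first split.
- by apply/ideal_genP => J [[]].
- move=> p q /ideal_genP Ip /ideal_genP Iq; apply/ideal_genP => J tJ rJ.
  by case: (tJ) => -[_ JB] _; apply: JB; [apply: Ip|apply: Iq].
- move=> a p /ideal_genP Ip; split; apply/ideal_genP => J tJ rJ.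
    exact: (tJ.2 a p (Ip J tJ rJ)).1.
  exact: (tJ.2 a p (Ip J tJ rJ)).2.
Qed.

Lemma ideal_gen_rel (rel : F -> F -> Prop) p q :
  rel p q -> p - q \in ideal_gen rel.
Proof. by move=> pq; apply/ideal_genP => J _; apply. Qed.

End FreeAlgebra.

Section Homogeneous.
Variables (K : fieldType) (X : choiceType) (G : zmodType) (wt : X -> G).
Local Notation F := (free_alg K X).
Implicit Types (p q : F) (m : {fmonom X}) (g h : G).

Definition wtm (m : seq X) : G := \sum_(x <- m) wt x.

Definition fproj g p : F :=
  [malg m in msupp p => if wtm m == g then p@_m else 0].

Lemma fprojE g p m : (fproj g p)@_m = if wtm m == g then p@_m else 0.
Proof. by rewrite mcoeffE; case: msuppP => // _; rewrite if_same. Qed.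

Lemma fproj_is_zmod_morphism g : zmod_morphism (fproj g).
Proof.
move=> p q; apply/malgP => m; rewrite mcoeffB !fprojE mcoeffB.
by case: ifP; rewrite ?subrr.
Qed.

HB.instance Definition _ g :=
  GRing.isZmodMorphism.Build F F (fproj g) (fproj_is_zmod_morphism g).

Lemma fprojU g c m : fproj g << c *g m >> = if wtm m == g then << c *g m >> else 0.
Proof.
apply/malgP => m'; rewrite fprojE mcoeffU.
case: (eqVneq m m') => [<-|/negbTE mm']; first by case: ifP; rewrite ?mcoeff0 ?mcoeffUU.
by rewrite mulr0n if_same; case: ifP; rewrite ?mcoeff0 // mcoeffU mm'.
Qed.

Lemma wtmM m m' : wtm (mmul m m') = wtm m + wtm m'.
Proof. by rewrite /wtm fmM big_cat. Qed.

Lemma malgUM (c c' : K) m m' :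
  << c *g m >> * << c' *g m' >> = << c * c' *g (mmul m m') >> :> F.
Proof. exact: fgmulUU. Qed.

Lemma fproj_mulUl g c m p :
  fproj g (<< c *g m >> * p) = << c *g m >> * fproj (g - wtm m) p.
Proof.
rewrite [p]monalgE mulr_sumr 2!(raddf_sum (fproj _)) mulr_sumr /=; apply: eq_bigr => m' _.
rewrite malgUM !fprojU wtmM.

have -> : (wtm m' == g - wtm m) = (wtm m + wtm m' == g).
  by rewrite eq_sym subr_eq addrC eq_sym.
by case: ifP; rewrite ?mulr0 ?malgUM.
Qed.

Lemma fproj_mulUr g c m p :
  fproj g (p * << c *g m >>) = fproj (g - wtm m) p * << c *g m >>.
Proof.
rewrite [p]monalgE mulr_suml 2!(raddf_sum (fproj _)) mulr_suml /=; apply: eq_bigr => m' _.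
rewrite malgUM !fprojU wtmM.
have -> : (wtm m' == g - wtm m) = (wtm m' + wtm m == g).
  by rewrite eq_sym subr_eq eq_sym.
by case: ifP; rewrite ?mul0r ?malgUM.
Qed.

Definition homog g p := fproj g p = p.

Lemma homog_proj g h p : homog g p -> fproj h p = if h == g then p else 0.
Proof.
move=> <-; apply/malgP => m; rewrite fprojE.
have [->|/negbTE hg] := eqVneq h g; first by rewrite fprojE; case: (wtm m == g).
by rewrite mcoeff0 fprojE; case: eqP => // ->; rewrite hg.
Qed.

Lemma homog0 g : homog g 0. Proof. exact: (raddf0 (fproj g)). Qed.

Lemma homogD g p q : homog g p -> homog g q -> homog g (p + q).
Proof. by rewrite /homog raddfD /= => -> ->. Qed.

Lemma homogB g p q : homog g p -> homog g q -> homog g (p - q).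
Proof. by rewrite /homog raddfB /= => -> ->. Qed.

Lemma homogZ g c p : homog g p -> homog g (c *: p).
Proof.
move=> gp; apply/malgP => m; rewrite fprojE !mcoeffZ.
by have := congr1 (mcoeff m) gp; rewrite fprojE; case: ifP => // _ <-; rewrite mulr0.
Qed.

Lemma homog_sum g (I : Type) (s : seq I) (P : pred I) (f : I -> F) :
  (forall i, P i -> homog g (f i)) -> homog g (\sum_(i <- s | P i) f i).
Proof. exact: (big_ind (homog g) (homog0 g) (@homogD g)). Qed.

Lemma homogM g h p q : homog g p -> homog h q -> homog (g + h) (p * q).
Proof.
move=> gp hq; rewrite /homog {1}[p]monalgE mulr_suml raddf_sum /=.
rewrite [in RHS](monalgE p) mulr_suml !big_seq; apply: eq_bigr => m mp.
rewrite fproj_mulUl (homog_proj _ hq).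
suff -> : wtm m = g by rewrite addrAC subrr add0r eqxx.
move: mp; rewrite -mcoeff_neq0 -gp fprojE.
by case: (wtm m =P g) => // _; rewrite eqxx.
Qed.

Lemma homog1 : homog 0 1.
Proof. by rewrite /homog [LHS]fprojU /wtm fm1 big_nil eqxx. Qed.

Lemma homogX g p n : homog g p -> homog (g *+ n) (p ^+ n).
Proof.
move=> gp; elim: n => [|n IH]; first exact: homog1.
by rewrite exprS mulrS; apply: homogM.
Qed.

Lemma homog_gen x : homog (wt x) (fgen K x).
Proof. by rewrite /homog fprojU /wtm fmU big_seq1 eqxx. Qed.

Lemma homog_prod (s : seq X) : homog (wtm s) (\prod_(x <- s) fgen K x).
Proof.
rewrite /wtm; elim: s => [|x s IH]; first by rewrite !big_nil; exact: homog1.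
by rewrite !big_cons; apply: homogM => //; apply: homog_gen.
Qed.

Variable rel : F -> F -> Prop.
Hypothesis rel_homog : forall p q, rel p q -> exists2 g, homog g p & homog g q.

Lemma ideal_gen_fproj g p : p \in ideal_gen rel -> fproj g p \in ideal_gen rel.
Proof.
have [[I0 IB] IM] := ideal_gen_two_sided rel.
have Isum (s : seq {fmonom X}) (f : {fmonom X} -> F) :
    (forall m, f m \in ideal_gen rel) -> \sum_(m <- s) f m \in ideal_gen rel.
  move=> fI; elim/big_ind: _ => // x y xI yI.
  by rewrite -[y]opprK IB // -sub0r IB.
pose J : {pred F} := fun p => `[< forall g, fproj g p \in ideal_gen rel >].
have JP q : reflect (forall g, fproj g q \in ideal_gen rel) (q \in J) by exact: asboolP.
move=> /ideal_genP Ip; apply/JP: g; apply: Ip => [|q q' qq'].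
  split; first split.
  - by apply/JP => g; rewrite raddf0.
  - move=> x y /JP Jx /JP Jy; apply/JP => g; rewrite raddfB.
    exact: IB (Jx g) (Jy g).
  - move=> a x /JP Jx; split; apply/JP => g; rewrite [a]monalgE.
      rewrite mulr_suml raddf_sum; apply: Isum => m /=.
      rewrite fproj_mulUl; exact: (IM _ _ (Jx _)).1.
    rewrite mulr_sumr raddf_sum; apply: Isum => m /=.
    rewrite fproj_mulUr; exact: (IM _ _ (Jx _)).2.
have [h hq hq'] := rel_homog qq'; apply/JP => g.
rewrite (homog_proj _ (homogB hq hq')).
by case: ifP => _ //; apply: ideal_gen_rel.
Qed.

End Homogeneous.

Section Generated.
Variables (K : fieldType) (A : algType K).
Implicit Types (P Q : A -> Prop) (S : {pred A}).

Definition span P : {pred A} := fun x =>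
  `[< forall S, submod_closed S -> (forall y, P y -> y \in S) -> x \in S >].

Definition subalg_gen P : {pred A} := fun x =>
  `[< forall S, GRing.subalg_closed S -> (forall y, P y -> y \in S) -> x \in S >].

Lemma spanP P x : reflect (forall S, submod_closed S ->
  (forall y, P y -> y \in S) -> x \in S) (x \in span P).
Proof. exact: asboolP. Qed.

Lemma subalg_genP P x : reflect (forall S, GRing.subalg_closed S ->
  (forall y, P y -> y \in S) -> x \in S) (x \in subalg_gen P).
Proof. exact: asboolP. Qed.

Lemma span_submod P : submod_closed (span P).
Proof.
split=> [|c x y /spanP xP /spanP yP]; apply/spanP => S sS PS; case: (sS) => // _.
by apply; [apply: xP|apply: yP].
Qed.

Lemma span_mem P x : P x -> x \in span P.
Proof. by move=> Px; apply/spanP => S _; apply. Qed.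

Lemma span_ind P S : submod_closed S -> (forall y, P y -> y \in S) ->
  forall x, x \in span P -> x \in S.
Proof. by move=> sS PS x /spanP; apply. Qed.

Lemma span_mul P Q R : (forall x y, P x -> Q y -> R (x * y)) ->
  forall x y, x \in span P -> y \in span Q -> x * y \in span R.
Proof.
move=> PQR x y xP yQ; have [R0 RL] := span_submod R.
pose S : {pred A} := fun x => x * y \in span R.
apply: (span_ind (S := S) _ _ xP) => [|u Pu].
  split; first by rewrite /S unfold_in /= mul0r.
  by move=> c u v; rewrite !unfold_in /S => uS vS; rewrite mulrDl -scalerAl; exact: RL.
rewrite unfold_in /S; pose T : {pred A} := fun y => u * y \in span R.
apply: (span_ind (S := T) _ _ yQ) => [|v Qv].
  split; first by rewrite /T unfold_in /= mulr0.
  by move=> c v w; rewrite !unfold_in /T => vT wT; rewrite mulrDr -scalerAr; exact: RL.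
by rewrite unfold_in /T; apply: span_mem; apply: PQR.
Qed.

Lemma subalg_gen_closed P : GRing.subalg_closed (subalg_gen P).
Proof.
split=> [|c x y /subalg_genP xP /subalg_genP yP|x y /subalg_genP xP /subalg_genP yP];
  apply/subalg_genP => S sS PS; case: (sS) => // _ SL SM.
- by apply: SL; [apply: xP|apply: yP].
- by apply: SM; [apply: xP|apply: yP].
Qed.

Lemma subalg_gen_mem P x : P x -> x \in subalg_gen P.
Proof. by move=> Px; apply/subalg_genP => S _; apply. Qed.

HB.instance Definition _ P := GRing.isSubalgClosed.Build K A (subalg_gen P)
  (subalg_gen_closed P).

Definition subalg P : Type := {x : A | x \in subalg_gen P}.

HB.instance Definition _ P := SubType.on (subalg P).
HB.instance Definition _ P := Choice.on (subalg P).
HB.instance Definition _ P := [SubChoice_isSubAlgebra of subalg P by <:].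

End Generated.

(* A generalized Cartan matrix is of finite type iff it has a positive definite
   symmetrization; the matrix being integral, rational vectors suffice. *)
Definition finite_cartan_matrix n (A : 'M[int]_n) : Prop :=
  [/\ forall i, A i i = 2,
      forall i j, i != j -> A i j <= 0,
      forall i j, A i j = 0 -> A j i = 0
    & exists D : 'I_n -> nat,
      [/\ forall i, (0 < D i)%N,
          forall i j, (D i)%:Z * A i j = (D j)%:Z * A j i
        & forall x : 'I_n -> rat, (exists i, x i != 0) ->
          0 < \sum_i \sum_j x i * ((D i)%:Z * A i j)%:~R * x j]].

Definition symmetrizer n (A : 'M[int]_n) (d : 'I_n -> nat) : Prop :=
  [/\ forall i, (0 < d i)%N,
      forall i j, (d i)%:Z * A i j = (d j)%:Z * A j i
    & \big[gcdn/0%N]_i d i = 1%N].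

(* Coordinates with respect to the simple roots. *)
Definition root_lattice n := 'rV[int]_n.

Definition simple_root n (i : 'I_n) : root_lattice n := delta_mx 0 i.

Definition positive_cone n : {pred root_lattice n} :=
  fun b => [forall i, 0 <= b 0 i].
Arguments positive_cone : clear implicits.

(* The Euler form on simple roots: <alpha_i, alpha_j>. *)
Definition euler n (A : 'M[int]_n) (d : 'I_n -> nat) (i j : 'I_n) : int :=
  if (i < j)%N then (d i)%:Z * A i j else if i == j then (d i)%:Z else 0.

(* (n)_v, (n)_v! and the Gaussian binomial as polynomials in v = 'X; the
   divisions are exact, and evaluation takes place only afterwards, so roots of
   unity are allowed. *)
Definition qint (K : fieldType) (n : nat) : {poly K} := ('X^n - 1) %/ ('X - 1).
Definition qfact (K : fieldType) (n : nat) : {poly K} :=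
  \prod_(1 <= i < n.+1) qint K i.
Definition qbinom (K : fieldType) (n k : nat) : {poly K} :=
  qfact K n %/ (qfact K k * qfact K (n - k)).

Variant Ugen n :=
  | GenE of 'I_n | GenF of 'I_n
  | GenW of 'I_n | GenWi of 'I_n     (* omega_i, omega_i^-1 *)
  | GenW' of 'I_n | GenW'i of 'I_n.  (* omega'_i, omega'_i^-1 *)

Definition Ugen_code n (x : Ugen n) : nat * 'I_n :=
  match x with
  | GenE i => (0%N, i) | GenF i => (1%N, i)
  | GenW i => (2%N, i) | GenWi i => (3%N, i)
  | GenW' i => (4%N, i) | GenW'i i => (5%N, i)
  end.

Definition Ugen_decode n (c : nat * 'I_n) : Ugen n :=
  match c with
  | (0%N, i) => GenE i | (1%N, i) => GenF i
  | (2%N, i) => GenW i | (3%N, i) => GenWi i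
  | (4%N, i) => GenW' i | (_, i) => GenW'i i
  end.

Lemma Ugen_codeK n : cancel (@Ugen_code n) (@Ugen_decode n).
Proof. by case. Qed.

HB.instance Definition _ n := Choice.copy (Ugen n) (can_type (@Ugen_codeK n)).

Definition is_toral n (x : Ugen n) : bool :=
  match x with GenE _ | GenF _ => false | _ => true end.

Section TwoParameter.
Variables (K : fieldType) (n : nat) (A : 'M[int]_n) (d : 'I_n -> nat) (r s : K).
Implicit Types i j : 'I_n.

Local Notation F := (free_alg K (Ugen n)).
Local Notation "<< i , j >>" := (euler A d i j).
Local Notation E i := (fgen K (GenE i) : F).
Local Notation Fg i := (fgen K (GenF i) : F).
Local Notation W i := (fgen K (GenW i) : F).
Local Notation Wi i := (fgen K (GenWi i) : F).
Local Notation W' i := (fgen K (GenW' i) : F).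
Local Notation W'i i := (fgen K (GenW'i i) : F).

Definition serre_exp i j : nat := `|1 - A i j|%N.

Definition serre_coef i j (k : nat) : K :=
  let v := r ^+ d i / s ^+ d i in
  (-1) ^+ k * (qbinom K (serre_exp i j) k).[v] *
  (v ^+ 'C(k, 2) * r ^ (k%:Z * <<j, i>>) * s ^ (- (k%:Z * <<i, j>>))).

Inductive Urel : F -> F -> Prop :=
  | R1_comm x y : is_toral x -> is_toral y ->
      Urel (fgen K x * fgen K y) (fgen K y * fgen K x)
  | R1_W i : Urel (W i * Wi i) 1
  | R1_W' i : Urel (W' i * W'i i) 1
  | R2_W i j :
      Urel (W i * E j * Wi i) (r ^ <<j, i>> * s ^ (- <<i, j>>) *: E j)
  | R2_W' i j :
      Urel (W' i * E j * W'i i) (r ^ (- <<i, j>>) * s ^ <<j, i>> *: E j)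
  | R3_W i j :
      Urel (W i * Fg j * Wi i) (r ^ (- <<j, i>>) * s ^ <<i, j>> *: Fg j)
  | R3_W' i j :
      Urel (W' i * Fg j * W'i i) (r ^ <<i, j>> * s ^ (- <<j, i>>) *: Fg j)
  | R4 i j :
      Urel (E i * Fg j - Fg j * E i)
        ((i == j)%:R *: ((r ^+ d i - s ^+ d i)^-1 *: (W i - W' i)))
  | R5 i j : i != j ->
      Urel (\sum_(0 <= k < (serre_exp i j).+1)
        serre_coef i j k *: (E i ^+ (serre_exp i j - k) * E j * E i ^+ k)) 0
  | R6 i j : i != j ->
      Urel (\sum_(0 <= k < (serre_exp i j).+1)
        serre_coef i j k *: (Fg i ^+ k * Fg j * Fg i ^+ (serre_exp i j - k))) 0.

Definition Uideal : {pred F} := ideal_gen Urel.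

(* 1 \notin Uideal: the character e_i, f_i |-> 0, omega_i, omega'_i |-> 1
   respects the relations. *)
Definition counit_mon (m : {fmonom (Ugen n)}) : K := (all (@is_toral n) m)%:R.

Lemma counit_mon_mmorphism : mmorphism counit_mon.
Proof.
split=> [x y|]; last by rewrite /counit_mon fm1.
by rewrite /counit_mon fmM all_cat -mulnb natrM.
Qed.

HB.instance Definition _ :=
  isMultiplicative.Build {fmonom (Ugen n)} K counit_mon counit_mon_mmorphism.

Definition counit : F -> K := mmap idfun counit_mon.
HB.instance Definition _ := GRing.RMorphism.on counit.

Lemma counitZ c p : counit (c *: p) = c * counit p.
Proof. exact: mmapZ. Qed.

Lemma counitM p q : counit (p * q) = counit p * counit q.
Proof. exact: rmorphM. Qed.

Lemma counitB p q : counit (p - q) = counit p - counit q.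
Proof. exact: rmorphB. Qed.

Lemma counit_mid p q q' : counit q = 0 -> counit (p * q * q') = 0.
Proof. by move=> q0; rewrite !rmorphM /= q0 mulr0 mul0r. Qed.

Lemma counit_gen x : counit (fgen K x) = (is_toral x)%:R.
Proof. by rewrite /counit mmapU /counit_mon fmU /= andbT mul1r. Qed.

Lemma counit_rel p q : Urel p q -> counit p = counit q.
Proof.
have e0 i : counit (E i) = 0 by rewrite counit_gen.
have f0 i : counit (Fg i) = 0 by rewrite counit_gen.
have w1 x y : is_toral x -> is_toral y ->
    counit (fgen K x * fgen K y) = counit 1.
  move=> tx ty; rewrite [LHS]counitM [RHS]rmorph1.
  by rewrite [X in X * _]counit_gen [X in _ * X]counit_gen tx ty mulr1.
have sum0 m (c : nat -> K) (f : nat -> F) : (forall k, counit (f k) = 0) ->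
    counit (\sum_(0 <= k < m) c k *: f k) = counit 0.
  move=> fk; rewrite [LHS]raddf_sum [RHS]raddf0; apply: big1 => k _.
  by rewrite [LHS]counitZ fk mulr0.
case=> [x y _ _|i|i|i j|i j|i j|i j|i j|i j _|i j _].
- exact: etrans (counitM _ _) (etrans (mulrC _ _) (esym (counitM _ _))).
- exact: w1.
- exact: w1.
- by rewrite [LHS]counit_mid ?e0 // [RHS]counitZ e0 mulr0.
- by rewrite [LHS]counit_mid ?e0 // [RHS]counitZ e0 mulr0.
- by rewrite [LHS]counit_mid ?f0 // [RHS]counitZ f0 mulr0.
- by rewrite [LHS]counit_mid ?f0 // [RHS]counitZ f0 mulr0.
- apply: etrans (counitB _ _) (etrans _ (esym (counitZ _ _))).
  rewrite [X in X - _]counitM [X in _ - X]counitM e0 mul0r mulr0 subrr.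
  by rewrite [X in _ * X]counitZ [X in _ * (_ * X)]counitB !counit_gen subrr !mulr0.
- by apply: sum0 => k; apply: counit_mid.
- by apply: sum0 => k; apply: counit_mid.
Qed.

Lemma Uideal_proper : 1 \notin Uideal.
Proof.
apply/negP => /ideal_genP /(_ [pred p | counit p == 0]) H.
suff : counit 1 == 0 by rewrite rmorph1 oner_eq0.
apply: H => [|p q /counit_rel pq]; last first.
  by rewrite inE [X in X == _]counitB pq subrr.
split=> [|a p]; first split.
- by rewrite inE [X in X == _]rmorph0.
- move=> p q; rewrite !inE => /eqP p0 /eqP q0.
  by rewrite [X in X == _]counitB p0 q0 subrr.
- move=> /eqP p0; split; apply/eqP.
    by apply: etrans (counitM a p) _; rewrite p0 mulr0.
  by apply: etrans (counitM p a) _; rewrite p0 mul0r.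
Qed.

HB.instance Definition _ := GRing.isZmodClosed.Build F Uideal
  (ideal_gen_two_sided Urel).1.
HB.instance Definition _ := isProperTwoSided.Build F Uideal
  (fun a x xI => ((ideal_gen_two_sided Urel).2 a x xI).1)
  (fun a x xI => ((ideal_gen_two_sided Urel).2 a x xI).2)
  Uideal_proper.

Definition U : algType K := quot_alg Uideal.

Definition Upi : F -> U := @quot_pi K F Uideal.

Definition Ue i : U := Upi (E i).

Definition Upos : algType K := subalg (fun x : U => exists i, x = Ue i).

Definition Upos_e i : Upos :=
  Sub (Ue i) (subalg_gen_mem (ex_intro (fun j => Ue i = Ue j) i erefl)).

Definition Upos_mon (w : seq 'I_n) : Upos := \prod_(i <- w) Upos_e i.

Definition wtE (w : seq 'I_n) : root_lattice n := \sum_(i <- w) simple_root i.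

Definition Upos_comp (b : root_lattice n) : {pred Upos} :=
  span (fun x => exists2 w, wtE w = b & x = Upos_mon w).

Definition Ugen_wt (x : Ugen n) : root_lattice n :=
  match x with
  | GenE i => simple_root i | GenF i => - simple_root i | _ => 0
  end.

Local Notation hg := (homog (K := K) Ugen_wt).

Let homogE i : hg (simple_root i) (E i). Proof. exact: (homog_gen K Ugen_wt (GenE i)). Qed.
Let homogF i : hg (- simple_root i) (Fg i). Proof. exact: (homog_gen K Ugen_wt (GenF i)). Qed.
Let homogT x : is_toral x -> hg 0 (fgen K x).
Proof. by case: x => // i _; exact: (homog_gen K Ugen_wt). Qed.

Let homogM3 x g p q q' : g = x -> hg 0 p -> hg x q -> hg 0 q' -> hg g (p * q * q').
Proof.
move=> -> hp hq hq'; rewrite -[x]addr0 -[in X in X + 0](add0r x).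
by apply: homogM => //; apply: homogM.
Qed.

Lemma Urel_homog p q : Urel p q -> exists2 g, hg g p & hg g q.
Proof.
case=> [x y tx ty|i|i|i j|i j|i j|i j|i j|i j _|i j _].
- by exists (0 + 0); apply: homogM; apply: homogT.
- exists (0 + 0); first by apply: homogM; apply: homogT.
  by rewrite addr0; apply: homog1.
- exists (0 + 0); first by apply: homogM; apply: homogT.
  by rewrite addr0; apply: homog1.
- exists (simple_root j); last exact: homogZ.
  by apply: (homogM3 (x := simple_root j)) => //; apply: homogT.
- exists (simple_root j); last exact: homogZ.
  by apply: (homogM3 (x := simple_root j)) => //; apply: homogT.
- exists (- simple_root j); last exact: homogZ.
  by apply: (homogM3 (x := - simple_root j)) => //; apply: homogT.
- exists (- simple_root j); last exact: homogZ.
  by apply: (homogM3 (x := - simple_root j)) => //; apply: homogT.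
- exists (simple_root i - simple_root j).
    apply: homogB; first exact: homogM.
    by rewrite addrC; apply: homogM.
  have [<-|_] := eqVneq i j; last by rewrite scale0r; apply: homog0.
  by rewrite subrr; do 2 apply: homogZ; apply: homogB; apply: homogT.
- exists (simple_root i *+ serre_exp i j + simple_root j); last exact: homog0.
  rewrite big_nat; apply: homog_sum => k; rewrite ltnS => /andP[_ km].
  apply: homogZ; rewrite -{1}(subnK km) mulrnDr -addrA [_ *+ k + _]addrC addrA.
  by apply: homogM; [apply: homogM|]; rewrite // ; apply: homogX.
- exists ((- simple_root i) *+ serre_exp i j - simple_root j); last exact: homog0.
  rewrite big_nat; apply: homog_sum => k; rewrite ltnS => /andP[_ km].
  apply: homogZ; rewrite -{1}(subnKC km) mulrnDr -addrA [_ *+ (_ - _) + _]addrC addrA.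
  by apply: homogM; [apply: homogM|]; rewrite // ; apply: homogX.
Qed.

Lemma Upos_monE w : val (Upos_mon w) = Upi (\prod_(i <- w) E i).
Proof.
rewrite [LHS](rmorph_prod (val : Upos -> U)) [RHS](rmorph_prod Upi).
by apply: eq_bigr.
Qed.

Lemma Upos_comp_lift b x : x \in Upos_comp b ->
  exists2 p, hg b p & val x = Upi p.
Proof.
pose S : {pred Upos} := fun x => `[< exists2 p, hg b p & val x = Upi p >].
move=> xb; apply/asboolP; move: x xb.
apply: (span_ind (S := S)) => [|x [w wb ->]]; last first.
  apply/asboolP; exists (\prod_(i <- w) E i); last exact: Upos_monE.
  have := homog_prod K Ugen_wt [seq GenE i | i <- w].
  by rewrite /wtm !big_map -wb.
split.
  apply/asboolP; exists 0; first exact: homog0.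
  by rewrite [LHS](raddf0 (val : Upos -> U)) [RHS](raddf0 Upi).
move=> c x y /asboolP[p hp xp] /asboolP[q hq yq]; apply/asboolP.
exists (c *: p + q); first exact: homogD (homogZ c hp) hq.
apply: etrans (linearP (val : Upos -> U) c x y) _.
exact: etrans (congr2 (fun u v : U => c *: u + v) xp yq) (esym (linearP Upi c p q)).
Qed.

Lemma Upos_span (x : Upos) : x \in span (fun x => exists w, x = Upos_mon w).
Proof.
set Sp := span _; have [S0 SL] : submod_closed Sp by apply: span_submod.
have SM (u v : Upos) : u \in Sp -> v \in Sp -> u * v \in Sp.
  apply: span_mul => _ _ [w ->] [w' ->]; exists (w ++ w').
  by rewrite /Upos_mon big_cat.
pose S : {pred U} := fun u => `[< exists2 y : Upos, y \in Sp & val y = u >].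
suff : val x \in S by case/asboolP => y yS /val_inj <-.
have /subalg_genP := valP x; apply=> [|_ [i ->]]; last first.
  apply/asboolP; exists (Upos_e i) => //; apply: span_mem.
  by exists [:: i]; rewrite /Upos_mon big_seq1.
split.
- apply/asboolP; exists 1; last exact: (rmorph1 (val : Upos -> U)).
  by apply: span_mem; exists [::]; rewrite /Upos_mon big_nil.
- move=> c _ _ /asboolP[y yS <-] /asboolP[z zS <-]; apply/asboolP.
  exists (c *: y + z); last exact: (linearP (val : Upos -> U)).
  exact: SL.
- move=> _ _ /asboolP[y yS <-] /asboolP[z zS <-]; apply/asboolP.
  by exists (y * z); [apply: SM|exact: (rmorphM (val : Upos -> U))].
Qed.

Lemma Upos_comp_submod b : submod_closed (Upos_comp b).
Proof. exact: span_submod. Qed.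

Lemma Upos_comp1 : 1 \in Upos_comp 0.
Proof.
by apply: span_mem; exists [::]; rewrite /wtE /Upos_mon big_nil.
Qed.

Lemma Upos_compM b c x y :
  x \in Upos_comp b -> y \in Upos_comp c -> x * y \in Upos_comp (b + c).
Proof.
apply: span_mul => _ _ [w wb ->] [w' wc ->]; exists (w ++ w').
  by rewrite /wtE big_cat /= -wb -wc.
by rewrite /Upos_mon big_cat.
Qed.

Lemma Upos_comp_sum x : exists2 f : {fsfun root_lattice n -> Upos with 0},
  forall b, f b \in Upos_comp b & x = \sum_(b <- finsupp f) f b.
Proof.
pose S : {pred Upos} := fun x => `[< exists2 f : {fsfun root_lattice n -> Upos with 0},
  forall b, f b \in Upos_comp b & x = \sum_(b <- finsupp f) f b >].
suff : x \in S by move/asboolP.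
have widen (f : {fsfun root_lattice n -> Upos with 0}) (T : {fset root_lattice n}) :
    (finsupp f `<=` T)%fset -> \sum_(b <- finsupp f) f b = \sum_(b <- T) f b.
  by move=> fS; apply: big_fset_incl => // b _; apply: fsfun_dflt.
apply: (span_ind _ _ (Upos_span x)) => [|_ [w ->]]; last first.
  pose f : {fsfun root_lattice n -> Upos with 0} :=
    [fsfun b in [fset wtE w]%fset => Upos_mon w].
  apply/asboolP; exists f.
    move=> b; rewrite fsfun_fun in_fset1; case: eqP => [->|_].
      by apply: span_mem; exists w.
    by case: (Upos_comp_submod b).
  rewrite (widen f [fset wtE w]%fset) ?big_seq_fset1 ?fsfun_fun ?in_fset1 ?eqxx //.
  by apply/fsubsetP => b; rewrite mem_finsupp fsfun_fun; case: ifP; rewrite ?eqxx.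
split.
  apply/asboolP; exists [fsfun]; first by move=> b; rewrite fsfun0E; case: (Upos_comp_submod b).
  by rewrite finsupp0 big_seq_fset0.
move=> c u v /asboolP[f fb ->] /asboolP[g gb ->]; apply/asboolP.
pose T := (finsupp f `|` finsupp g)%fset.
pose h : {fsfun root_lattice n -> Upos with 0} := [fsfun b in T => c *: f b + g b].
have hE b : h b = c *: f b + g b.
  rewrite fsfun_fun; case: ifPn => //; rewrite in_fsetU negb_or => /andP[fb0 gb0].
  by rewrite !fsfun_dflt // scaler0 addr0.
exists h; first by move=> b; rewrite hE; case: (Upos_comp_submod b) => _; apply.
rewrite (widen h T); last first.
  by apply/fsubsetP => b; rewrite mem_finsupp fsfun_fun; case: ifP; rewrite ?eqxx.
rewrite (widen f T) ?fsubsetUl // (widen g T) ?fsubsetUr //.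
by rewrite scaler_sumr -big_split /=; apply: eq_bigr => b _; rewrite hE.
Qed.

Lemma Upos_comp_direct (f : {fsfun root_lattice n -> Upos with 0}) :
  (forall b, f b \in Upos_comp b) -> \sum_(b <- finsupp f) f b = 0 ->
  forall b, f b = 0.
Proof.
move=> fb f0 b; have [bf|/fsfun_dflt //] := boolP (b \in finsupp f).
pose lift c := cid2 (Upos_comp_lift (fb c)).
pose P c := s2val (lift c).
have Ph c : hg c (P c) := s2valP (lift c).
have Pf c : val (f c) = Upi (P c) := s2valP' (lift c).
have UpiI p : p \in Uideal -> Upi p = 0.
  move=> pI; rewrite -(raddf0 Upi); apply/quot_piP; by rewrite subr0.
have sumI : \sum_(c <- finsupp f) P c \in Uideal.
  rewrite -[X in X \in _]subr0; apply/quot_piP.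
  apply: etrans (raddf_sum Upi _ _ _) _.
  apply: etrans (etrans _ (raddf0 (val : Upos -> U))) (esym (raddf0 Upi)).
  apply: etrans (etrans _ (esym (raddf_sum (val : Upos -> U) _ _ _))) (congr1 val f0).
  by apply: eq_bigr => c _; exact: esym (Pf c).
apply: val_inj; rewrite [RHS](raddf0 (val : Upos -> U)) Pf; apply: UpiI.
have := ideal_gen_fproj Urel_homog b sumI.
rewrite (raddf_sum (fproj Ugen_wt b)) (big_fsetD1 b) //= [fproj _ b (P b)]Ph big1_fset ?addr0 //.
move=> c; rewrite in_fsetD1 => /andP[cb _] _.
by rewrite (homog_proj b (Ph c)) eq_sym (negPf cb).
Qed.

Definition Upos_grading : grading (root_lattice n) Upos :=
  Grading Upos_comp_submod Upos_comp1 Upos_compM Upos_comp_sum Upos_comp_direct.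

Lemma Upos_e_degree i : Upos_e i \in Upos_grading (simple_root i).
Proof.
by apply: span_mem; exists [:: i]; rewrite /wtE /Upos_mon big_seq1.
Qed.

Lemma Upos_grading_positive b x :
  b \notin positive_cone n -> x \in Upos_grading b -> x = 0.
Proof.
move=> bQ; suff : x \in Upos_grading b -> x \in [pred x | x == 0].
  by move=> h /h /eqP.
apply: (span_ind (S := [pred x : Upos | x == 0])) => [|_ [w wb ->]].
  split=> [|c u v /eqP -> /eqP ->]; first exact: eqxx.
  by apply/eqP; rewrite scaler0 addr0.
case/negP: bQ; rewrite -wb; apply/forallP => i; rewrite /wtE summxE.
by apply: sumr_ge0 => j _; rewrite mxE; case: (_ && _).
Qed.

End TwoParameter.

(* Main.v *)
Require Import Defs.
From HB Require Import structures.
From mathcomp Require Import all_boot all_order all_algebra.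
From mathcomp Require Import finmap monalg boolp reals complex.
From mathcomp Require Import ring zify.

Set Implicit Arguments.
Unset Strict Implicit.
Unset Printing Implicit Defensive.

Import Order.TTheory GRing.Theory Num.Theory.
Local Open Scope ring_scope.

(** Write U(r,s) for the two-parameter algebra, I(r,s) for its defining ideal in
    the free algebra F, B for the bilinear extension of the Euler form to the
    root lattice, and a_i for the simple roots.  The positive part is a subalgebra
    of U(r,s), not an algebra given by generators and relations; the proof
    nevertheless avoids any presentation of it (hence any triangular
    decomposition) by comparing the two ideals I(r,s) and I(r',s') inside F.

    Case r / s = r' / s', so that r = t r' and s = t s' for some t.  Let U(r',s')
    act on itself by operators that combine left multiplication with a power of
    t depending bilinearly on degrees: e_i acts as y |-> t^B(deg y, a_i) e_i y,
    f_i as y |-> t^(- B(a_i, deg y)) f_i y, and omega_i, omega'_i as left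
    multiplication composed with y |-> t^(B(deg y, a_i) - B(a_i, deg y)) y.
    The powers of t absorb the discrepancy between the structure constants of
    the relations for (t r', t s') and for (r', s'), so these operators satisfy
    the relations of U(t r', t s').  At the level of F, a word w goes to a power
    of t times w, and this linear map, wtwist, sends I(t r', t s') into
    I(r', s'): this is Uideal_twist, an instance of the criterion
    wtwist_ideal_gen.

    Case r / s = s' / r'.  Exchanging omega_i and omega'_i identifies U(r,s) with
    U(s,r) and fixes every e_i (Uideal_swap).  Only the Serre relations need an
    argument, namely the symmetry of their coefficients under exchange of r and
    s (serre_coef_swap), which amounts to the palindromicity of the Gaussian
    binomials (qbinom_inv) and to d_i a_ij = B(a_i, a_j) + B(a_j, a_i) for i != j.
    This reduces the second case to the first one.

    Restricted to words in the e_i, the transfer of ideals yields a linear map of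
    positive parts that multiplies the monomial of a word w by
    t^(word_exp w) (Upos_linear_map), and the same construction with t^-1 yields
    its inverse.  Since word_exp (w w') - word_exp w - word_exp w' equals
    B(deg w', deg w), this map is multiplicative for the product twisted by the
    bicharacter psi(g, h) = t^(- B(h, g)), which is a 2-cocycle. *)

(** * Ideals of the free algebra *)

Section IdealGen.
Variables (K : fieldType) (X : choiceType) (rel : free_alg K X -> free_alg K X -> Prop).
Local Notation F := (free_alg K X).
Local Notation I := (ideal_gen rel).

Lemma ideal_gen0 : 0 \in I.
Proof. by case: (ideal_gen_two_sided rel) => -[]. Qed.

Lemma ideal_genB p q : p \in I -> q \in I -> p - q \in I.
Proof. by case: (ideal_gen_two_sided rel) => -[_ IB] _; apply: IB. Qed.

Lemma ideal_genD p q : p \in I -> q \in I -> p + q \in I.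
Proof.
move=> pI qI; rewrite -[q]opprK; apply: ideal_genB => //.
by rewrite -sub0r; apply: ideal_genB => //; apply: ideal_gen0.
Qed.

Lemma ideal_gen_mull a p : p \in I -> a * p \in I.
Proof. by move=> pI; exact: ((ideal_gen_two_sided rel).2 a p pI).1. Qed.

Lemma ideal_gen_mulr a p : p \in I -> p * a \in I.
Proof. by move=> pI; exact: ((ideal_gen_two_sided rel).2 a p pI).2. Qed.

Lemma ideal_genZ c p : p \in I -> c *: p \in I.
Proof. by move=> pI; rewrite -[c *: p]mulr_algl; exact: ideal_gen_mull. Qed.

Lemma ideal_gen_sum (J : Type) (s : seq J) (f : J -> F) :
  (forall j, f j \in I) -> \sum_(j <- s) f j \in I.
Proof.
move=> fI; elim/big_ind: _ => //; [exact: ideal_gen0|exact: ideal_genD].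
Qed.

End IdealGen.

(** * Twisting words by powers of a scalar *)

Lemma scaleMM (K : fieldType) (X : choiceType) (a b : K) (p q : free_alg K X) :
  (a *: p) * (b *: q) = (a * b) *: (p * q).
Proof. by rewrite -scalerAl -scalerAr scalerA. Qed.

Section WordTwist.
Variables (K : fieldType) (X : choiceType) (G : zmodType) (wt : X -> G).
Variables (sigma : X -> X) (t : K) (N : X -> G -> int).
Local Notation F := (free_alg K X).
Implicit Types (p q : F) (m : {fmonom X}) (g h : G).

(** Each letter of a word acts on what stands to its right: the letter x, applied
    to something of degree h, contributes t ^ N x h.  Here g is the degree of an
    element to which the whole word is applied. *)
Fixpoint wexp (m : seq X) g : int :=
  if m is x :: m' then N x (wtm wt m' + g) + wexp m' g else 0.

Definition wtwist_mon g (m : {fmonom X}) : F :=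
  t ^ wexp m g *: \prod_(x <- m) fgen K (sigma x).

Definition wtwist g p : F := mmap (fun c : K => c%:MP) (wtwist_mon g) p.

Lemma wtwist_is_zmod_morphism g : zmod_morphism (wtwist g).
Proof. exact: mmapB. Qed.

HB.instance Definition _ g :=
  GRing.isZmodMorphism.Build F F (wtwist g) (wtwist_is_zmod_morphism g).

Lemma wtwistU g c m : wtwist g << c *g m >> = c *: wtwist_mon g m.
Proof. by rewrite /wtwist mmapU mul_malgC. Qed.

Lemma wtwistZ g c p : wtwist g (c *: p) = c *: wtwist g p.
Proof.
rewrite /wtwist (mmapEw (msuppZ_le _ _)) mmapE scaler_sumr.
apply: eq_bigr => m _.
rewrite mcoeffZ 2!mul_malgC; exact: (esym (scalerA _ _ _)).
Qed.

Lemma wtwist_lin g c p q : wtwist g (c *: p + q) = c *: wtwist g p + wtwist g q.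
Proof. by rewrite raddfD /= wtwistZ. Qed.

Lemma wtwist_gen g x : wtwist g (fgen K x) = t ^ N x g *: fgen K (sigma x).
Proof.
rewrite /fgen wtwistU scale1r /wtwist_mon fmU /= big_seq1.
by rewrite /wtm big_nil add0r addr0.
Qed.

Lemma wexp_cat (m m' : seq X) g : wexp (m ++ m') g = wexp m (wtm wt m' + g) + wexp m' g.
Proof.
elim: m => [|x m IH] /=; first by rewrite add0r.
by rewrite IH /wtm big_cat /= !addrA.
Qed.

Hypothesis t0 : t != 0.

Lemma wtwist_monM g m m' :
  wtwist_mon g (mmul m m') = wtwist_mon (wtm wt m' + g) m * wtwist_mon g m'.
Proof.
rewrite /wtwist_mon fmM wexp_cat big_cat /= expfzDr //.
exact: (esym (scaleMM _ _ _ _)).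
Qed.

(** The left factor acts on the right one, whose degree h therefore shifts the
    degree seen by the left factor. *)
Lemma wtwistM g h p q : homog wt h q ->
  wtwist g (p * q) = wtwist (h + g) p * wtwist g q.
Proof.
move=> hq; rewrite [p]monalgE mulr_suml !raddf_sum mulr_suml /=.
apply: eq_bigr => m _.
rewrite [q]monalgE mulr_sumr !raddf_sum mulr_sumr /= !big_seq.
apply: eq_bigr => m' qm'.
have -> : h = wtm wt m'.
  move: qm'; rewrite -mcoeff_neq0 -hq fprojE.
  by case: (wtm wt m' =P h) => // _; rewrite eqxx.
rewrite malgUM 3!wtwistU wtwist_monM; exact: (esym (scaleMM _ _ _ _)).
Qed.

Lemma wtwist1 g : wtwist g 1 = 1.
Proof. by rewrite [LHS]wtwistU scale1r /wtwist_mon fm1 /= big_nil scale1r. Qed.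

Lemma fproj_sum p :
  p = \sum_(h <- undup [seq wtm wt m | m : {fmonom X} <- msupp p]) fproj wt h p.
Proof.
apply/malgP => m; rewrite raddf_sum /=.
under eq_bigr => h _ do rewrite fprojE.
have [mp|mp] := boolP (m \in msupp p); last first.
  rewrite (mcoeff_outdom mp) big1 // => h _.
  by rewrite if_same.
rewrite (bigD1_seq (wtm wt m)) ?undup_uniq //=; last first.
  by rewrite mem_undup; apply/mapP; exists m.
rewrite eqxx big1 ?addr0 // => h /negbTE.
by rewrite eq_sym => ->.
Qed.

(** The operators on F modulo the ideal of rel' given by the twisted letters satisfy
    the relations rel as soon as each relation is respected at every degree g. *)
Lemma wtwist_ideal_gen (rel rel' : F -> F -> Prop) :
  (forall p q, rel p q -> exists2 h, homog wt h p & homog wt h q) ->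
  (forall g p q, rel p q -> wtwist g (p - q) \in ideal_gen rel') ->
  forall g p, p \in ideal_gen rel -> wtwist g p \in ideal_gen rel'.
Proof.
move=> relh relI g p Ip.
(* wtwist is multiplicative only on homogeneous right factors; testing every *)
(* homogeneous component makes J a two-sided ideal.                          *)
pose J : {pred F} := fun p =>
  `[< forall g h, wtwist g (fproj wt h p) \in ideal_gen rel' >].
have JP q : reflect (forall g h, wtwist g (fproj wt h q) \in ideal_gen rel')
              (q \in J) by exact: asboolP.
have fprojh h q : homog wt h (fproj wt h q).
  by apply/malgP => m; rewrite !fprojE; case: (wtm wt m == h).
have /JP Jp : p \in J; last first.
  rewrite [p]fproj_sum raddf_sum; apply: ideal_gen_sum => h; exact: Jp.
move/ideal_genP: Ip; apply=> [|q q' qq'].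
  split; first split.
  - apply/JP => g' h; rewrite !raddf0; exact: ideal_gen0.
  - move=> x y /JP Jx /JP Jy; apply/JP => g' h; rewrite !raddfB /=.
    by apply: ideal_genB.
  - move=> a x /JP Jx; split; apply/JP => g' h.
      rewrite [a]monalgE mulr_suml !raddf_sum; apply: ideal_gen_sum => m /=.
      by rewrite fproj_mulUl (wtwistM _ _ (fprojh _ _)) ideal_gen_mull.
    rewrite [a]monalgE mulr_sumr !raddf_sum; apply: ideal_gen_sum => m /=.
    have mh : homog wt (wtm wt m) << a@_m *g m >> by rewrite /homog fprojU eqxx.
    by rewrite fproj_mulUr (wtwistM _ _ mh) ideal_gen_mulr.
have [h hq hq'] := relh _ _ qq'; apply/JP => g' h'.
rewrite (homog_proj _ (homogB hq hq')).
case: ifP => _; first exact: relI.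
by rewrite raddf0 ideal_gen0.
Qed.

Section Monomials.
Hypothesis ND : forall x g h, N x (g + h) = N x g + N x h.

Lemma wtwist_genX g x k :
  wtwist g (fgen K x ^+ k) =
  t ^ (N x (wt x) * 'C(k, 2)%:Z + k%:Z * N x g) *: fgen K (sigma x) ^+ k.
Proof.
elim: k => [|k IH]; first by rewrite !expr0 wtwist1 bin0n mulr0 mul0r addr0 scale1r.
rewrite exprS (wtwistM _ _ (homogX k (homog_gen K wt x))) IH wtwist_gen.
rewrite scaleMM [in RHS]exprS; apply: (congr1 ( *:%R^~ _)) => /=.
rewrite -expfzDr //; congr (t ^ _).
have -> : N x (wt x *+ k + g) = k%:Z * N x (wt x) + N x g.
  elim: (k) => [|l IHl]; first by rewrite mulr0n add0r mul0r add0r.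
  by rewrite mulrS -addrA ND IHl addrA -[l.+1%:Z]natz -natr1 natz; ring.
by rewrite binS bin1 PoszD -[k.+1%:Z]natz -natr1 natz; ring.
Qed.

(** The part of the exponent that is quadratic in k and l depends on k + l only,
    because 'C(k + l, 2) = 'C(k, 2) + 'C(l, 2) + k * l.  So along the terms of a
    Serre relation the exponent is an affine function of the summation index. *)
Lemma wtwist_serre_monomial g x y k l :
  wtwist g (fgen K x ^+ k * fgen K y * fgen K x ^+ l) =
  t ^ (N x (wt x) * 'C(k + l, 2)%:Z + k%:Z * N x (wt y) + l%:Z * N y (wt x)
       + (k + l)%:Z * N x g + N y g)
    *: (fgen K (sigma x) ^+ k * fgen K (sigma y) * fgen K (sigma x) ^+ l).
Proof.
have hX i : homog wt (wt x *+ i) (fgen K x ^+ i) := homogX i (homog_gen K wt x).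
rewrite (wtwistM _ _ (hX l)) (wtwistM _ _ (homog_gen K wt y)) !wtwist_genX wtwist_gen.
rewrite 2!scaleMM; apply: (congr1 ( *:%R^~ _)) => /=; rewrite -!expfzDr //; congr (t ^ _).
have NX z i h : N z (wt x *+ i + h) = i%:Z * N z (wt x) + N z h.
  elim: i => [|i IHi]; first by rewrite mulr0n add0r mul0r add0r.
  by rewrite mulrS -addrA ND IHi addrA -[i.+1%:Z]natz -natr1 natz; ring.
have -> : 'C(k + l, 2)%:Z = 'C(k, 2)%:Z + 'C(l, 2)%:Z + k%:Z * l%:Z.
  suff -> : 'C(k + l, 2) = ('C(k, 2) + 'C(l, 2) + k * l)%N by lia.
  elim: (k) => [|i IHi]; first by rewrite bin0n mul0n addn0.
  by rewrite addSn !binS !bin1 IHi; lia.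
by rewrite ND !NX PoszD; ring.
Qed.
End Monomials.
End WordTwist.

(** * Palindromicity of the Gaussian binomials *)

Section GaussianBinomial.
Variable K : fieldType.

Lemma qintE n : qint K n = \sum_(i < n) 'X^i.
Proof.
by rewrite /qint subrX1 mulrC mulpK // polyXsubC_eq0.
Qed.

Lemma qintD m n : qint K (m + n) = qint K m + 'X^m * qint K n.
Proof.
rewrite !qintE big_split_ord /= mulr_sumr; congr (_ + _).
by apply: eq_bigr => i _; rewrite exprD.
Qed.

Lemma qint_neq0 n : qint K n.+1 != 0.
Proof.
apply/eqP => /(congr1 (horner^~ 0)) /eqP.
rewrite qintE horner_sum big_ord_recl hornerXn expr0 horner0 big1 => [|i _].
  by rewrite addr0 oner_eq0.
by rewrite hornerXn expr0n.
Qed.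

Lemma qfactS n : qfact K n.+1 = qint K n.+1 * qfact K n.
Proof. by rewrite /qfact big_nat_recr //= mulrC. Qed.

Lemma qfact_neq0 n : qfact K n != 0.
Proof.
elim: n => [|n IH]; first by rewrite /qfact big_geq // oner_neq0.
by rewrite qfactS mulf_neq0 ?qint_neq0.
Qed.

(** The Gaussian binomials through one of their two Pascal rules; qpascalS is the
    other rule.  The substitution of v^-1 for v exchanges the two rules. *)
Fixpoint qpascal n k : {poly K} :=
  match n, k with
  | _, 0%N => 1
  | 0%N, _.+1 => 0
  | n'.+1, k'.+1 => qpascal n' k' + 'X^(k'.+1) * qpascal n' k'.+1
  end.

Lemma qpascal0 n : qpascal n 0 = 1. Proof. by case: n. Qed.

Lemma qpascal_small n k : (n < k)%N -> qpascal n k = 0.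
Proof.
elim: n k => [|n IH] [|k] //= nk.
by rewrite !IH ?mulr0 ?addr0 // ltnW.
Qed.

Lemma qpascal_fact n k : (k <= n)%N ->
  qpascal n k * (qfact K k * qfact K (n - k)) = qfact K n.
Proof.
elim: n k => [|n IH] [|k] //= kn.
- by rewrite /qfact big_geq // !mul1r.
- by rewrite subn0 mul1r /qfact big_geq ?mul1r.
rewrite subSS mulrDl {1}qfactS [X in X + _](_ : _ = qint K k.+1 * qfact K n); last first.
  by rewrite -(IH k) //; ring.
have [kn'|] := ltnP k n; last first.
  move=> nk; have -> : k = n by apply/eqP; rewrite eqn_leq nk andbT -ltnS.
  by rewrite qpascal_small // mulr0 mul0r addr0 qfactS.
have -> : (n - k = (n - k.+1).+1)%N by lia.
have -> : qfact K n.+1 = (qint K k.+1 + 'X^(k.+1) * qint K (n - k.+1).+1) * qfact K n.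
  by rewrite qfactS -qintD; congr (qint K _ * _); lia.
by rewrite -(IH k.+1) // (qfactS (n - k.+1)); ring.
Qed.

Lemma qbinomE n k : (k <= n)%N -> qbinom K n k = qpascal n k.
Proof.
move=> kn; rewrite /qbinom -(qpascal_fact kn) mulpK //.
by rewrite mulf_neq0 ?qfact_neq0.
Qed.

Lemma qpascalS n k : (k <= n)%N ->
  qpascal n.+1 k.+1 = 'X^(n - k) * qpascal n k + qpascal n k.+1.
Proof.
move=> kn; have [kn'|nk] := ltnP k n; last first.
  have -> : k = n by apply/eqP; rewrite eqn_leq nk andbT.
  by rewrite subnn mul1r /= (@qpascal_small n n.+1) // mulr0.
apply: (mulIf (mulf_neq0 (qfact_neq0 k.+1) (qfact_neq0 (n - k)))).
rewrite -[(n - k)%N in LHS]subSS qpascal_fact // mulrDl.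
have nkE : (n - k = (n - k.+1).+1)%N by lia.
rewrite [X in _ = X + _](_ : _ = 'X^(n - k) * qint K k.+1 * qfact K n); last first.
  by rewrite -(qpascal_fact kn) (qfactS k); ring.
rewrite [X in _ = _ + X](_ : _ = qint K (n - k) * qfact K n); last first.
  by rewrite -(qpascal_fact kn') nkE (qfactS (n - k.+1)); ring.
have -> : qfact K n.+1 = (qint K (n - k) + 'X^(n - k) * qint K k.+1) * qfact K n.
  by rewrite qfactS -qintD; congr (qint K _ * _); lia.
by ring.
Qed.

(** As a polynomial of degree k (n - k), a Gaussian binomial is palindromic.  The
    induction on Pascal's rule holds for every nonzero v, roots of unity included. *)
Lemma qpascal_inv n k (v : K) : v != 0 -> (k <= n)%N ->
  (qpascal n k).[v^-1] * v ^+ (k * (n - k)) = (qpascal n k).[v].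
Proof.
move=> v0; elim: n k => [|n IH] [|k] // kn.
- by rewrite qpascal0 mul0n !hornerC mulr1.
- by rewrite qpascal0 mul0n !hornerC mulr1.
rewrite ltnS in kn.
have -> : qpascal n.+1 k.+1 = qpascal n k + 'X^(k.+1) * qpascal n k.+1 by [].
rewrite -[X in _ = X.[v]]/(qpascal n.+1 k.+1) qpascalS // !hornerD !hornerM.
rewrite !hornerXn subSS mulrDl.
congr (_ + _).
  by rewrite mulSn exprD mulrCA IH.
have [kn'|nk] := ltnP k n; last by rewrite qpascal_small // !horner0 mulr0 mul0r.
rewrite -IH //.
have -> : (n - k = (n - k.+1).+1)%N by lia.
by rewrite mulnS exprD exprVn; field; rewrite expf_neq0.
Qed.

Lemma qbinom_inv n k (v : K) : v != 0 -> (k <= n)%N ->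
  (qbinom K n k).[v^-1] = (qbinom K n k).[v] * v ^- (k * (n - k)).
Proof.
move=> v0 kn; rewrite qbinomE // -[in RHS](qpascal_inv v0 kn) mulfK //.
by rewrite expf_neq0.
Qed.

End GaussianBinomial.

(** * The Euler form on the root lattice *)

Section EulerForm.
Variables (n : nat) (A : 'M[int]_n) (d : 'I_n -> nat).
Implicit Types (g h : root_lattice n) (i j : 'I_n).

Definition euler_form g h : int := \sum_i \sum_j g 0 i * euler A d i j * h 0 j.

Lemma euler_formDl g g' h : euler_form (g + g') h = euler_form g h + euler_form g' h.
Proof.
rewrite /euler_form -big_split; apply: eq_bigr => i _.
by rewrite -big_split; apply: eq_bigr => j _; rewrite /= mxE !mulrDl.
Qed.

Lemma euler_formDr g h h' : euler_form g (h + h') = euler_form g h + euler_form g h'.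
Proof.
rewrite /euler_form -big_split; apply: eq_bigr => i _.
by rewrite -big_split; apply: eq_bigr => j _; rewrite /= mxE !mulrDr.
Qed.

Lemma euler_form0l h : euler_form 0 h = 0.
Proof. by apply: (addIr (euler_form 0 h)); rewrite -euler_formDl !add0r. Qed.

Lemma euler_form0r g : euler_form g 0 = 0.
Proof. by apply: (addIr (euler_form g 0)); rewrite -euler_formDr !add0r. Qed.

Lemma euler_formNl g h : euler_form (- g) h = - euler_form g h.
Proof. by apply: (addIr (euler_form g h)); rewrite -euler_formDl !addNr euler_form0l. Qed.

Lemma euler_formNr g h : euler_form g (- h) = - euler_form g h.
Proof. by apply: (addIr (euler_form g h)); rewrite -euler_formDr !addNr euler_form0r. Qed.

Lemma euler_form_simple i j :
  euler_form (simple_root i) (simple_root j) = euler A d i j.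
Proof.
rewrite /euler_form (bigD1 i) //= (bigD1 j) //= !mxE !eqxx mul1r mulr1.
rewrite big1 => [|j' /negbTE j'j]; last by rewrite !mxE j'j andbF mulr0.
rewrite big1 ?addr0 // => i' /negbTE i'i; apply: big1 => j' _.
by rewrite !mxE i'i andbF !mul0r.
Qed.

Definition euler_formE := (euler_formDl, euler_formDr, euler_formNl, euler_formNr,
  euler_form0l, euler_form0r, euler_form_simple).

Lemma euler_diag i : euler A d i i = (d i)%:Z.
Proof. by rewrite /euler ltnn eqxx. Qed.

(** The exponent of t by which a generator is twisted when it acts on something of
    degree h.  The exponents for e_i and f_j are tied together by the relation
    between e_i f_j and f_j e_i, whose two terms must be twisted alike; those for
    omega_i and omega'_i are the sum of the exponents for e_i and f_i, as the
    right hand side of the same relation requires. *)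
Definition Ugen_exp (x : Ugen n) h : int :=
  match x with
  | GenE i => euler_form h (simple_root i)
  | GenF i => - euler_form (simple_root i) h
  | GenW i | GenW' i =>
      euler_form h (simple_root i) - euler_form (simple_root i) h
  | GenWi i | GenW'i i =>
      euler_form (simple_root i) h - euler_form h (simple_root i)
  end.

Lemma Ugen_expD x g h : Ugen_exp x (g + h) = Ugen_exp x g + Ugen_exp x h.
Proof. by case: x => i /=; rewrite !euler_formE; ring. Qed.

End EulerForm.

(** * From parameters (tr, ts) to (r, s) *)

Section Transfer.
Variables (K : fieldType) (n : nat) (A : 'M[int]_n) (d : 'I_n -> nat).
Implicit Types (i j : 'I_n) (g h : root_lattice n).
Local Notation F := (free_alg K (Ugen n)).
Local Notation N := (Ugen_exp A d).
Local Notation Th t := (wtwist (K := K) (@Ugen_wt n) id t N).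

Lemma serre_coef_scale (t r s : K) i j k : t != 0 -> r != 0 -> s != 0 ->
  serre_coef A d (t * r) (t * s) i j k =
  t ^ (k%:Z * (euler A d j i - euler A d i j)) * serre_coef A d r s i j k.
Proof.
move=> t0 r0 s0; rewrite /serre_coef.
have -> : (t * r) ^+ d i / (t * s) ^+ d i = r ^+ d i / s ^+ d i.
  by rewrite !exprMn; field; rewrite !expf_neq0.
have -> : k%:Z * (euler A d j i - euler A d i j) =
  k%:Z * euler A d j i + - (k%:Z * euler A d i j) by rewrite mulrBr.
rewrite !expfzMl expfzDr //.
move: (t ^ _) (t ^ _) (r ^ _) (s ^ _) (_.[_]) => a b c e f; ring.
Qed.

Section Twist.
Variables (t r s : K).
Hypotheses (t0 : t != 0) (r0 : r != 0) (s0 : s != 0).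
Local Notation I := (Uideal A d r s).

Lemma twist_rel g c p q p' q' : Urel A d r s p' q' ->
  Th t g p = c *: p' -> Th t g q = c *: q' -> Th t g (p - q) \in I.
Proof.
move=> pq' pE qE; rewrite raddfB /= pE qE -scalerBr.
exact/ideal_genZ/ideal_gen_rel.
Qed.

(** Both Serre relations at once: with a decreasing and b increasing in k for the
    e_i, and conversely for the f_i.  The word in position k is twisted by the
    power of t in the second hypothesis. *)
Lemma twist_serre (x : 'I_n -> Ugen n) g i j m (a b : nat -> nat) (C : K)
    (c c' : nat -> K) :
  (forall k, k <= m -> a k + b k = m)%N ->
  (forall k, (k <= m)%N ->
     c k * t ^ (N (x i) (Ugen_wt (x i)) * 'C(m, 2)%:Z +
       (a k)%:Z * N (x i) (Ugen_wt (x j)) + (b k)%:Z * N (x j) (Ugen_wt (x i)) +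
       m%:Z * N (x i) g + N (x j) g) = C * c' k) ->
  Th t g (\sum_(0 <= k < m.+1) c k *:
     (fgen K (x i) ^+ a k * fgen K (x j) * fgen K (x i) ^+ b k)) =
  C *: \sum_(0 <= k < m.+1) c' k *:
     (fgen K (x i) ^+ a k * fgen K (x j) * fgen K (x i) ^+ b k).
Proof.
move=> abm cc'; rewrite raddf_sum scaler_sumr /= !big_nat; apply: eq_bigr => k /andP[_ km].
rewrite ltnS in km.
rewrite wtwistZ (wtwist_serre_monomial (@Ugen_wt n) id t0 (Ugen_expD A d)) (abm k km).
apply: etrans (scalerA _ _ _) (etrans _ (esym (scalerA _ _ _))).
apply: (congr1 ( *:%R^~ _)); exact: cc'.
Qed.

Lemma twist_gen2 g x y :
  Th t g (fgen K x * fgen K y) =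
  t ^ (N x (Ugen_wt y + g) + N y g) *: (fgen K x * fgen K y).
Proof.
rewrite (wtwistM _ _ t0 _ _ (homog_gen K (@Ugen_wt n) y)) !wtwist_gen scaleMM.
by rewrite -expfzDr.
Qed.

Lemma twist_gen3 g x y z :
  Th t g (fgen K x * fgen K y * fgen K z) =
  t ^ (N x (Ugen_wt y + (Ugen_wt z + g)) + N y (Ugen_wt z + g) + N z g) *:
    (fgen K x * fgen K y * fgen K z).
Proof.
rewrite (wtwistM _ _ t0 _ _ (homog_gen K (@Ugen_wt n) z)) twist_gen2 wtwist_gen scaleMM.
by rewrite -expfzDr.
Qed.

(** Every relation for (tr, ts) is twisted to a scalar multiple of the same relation
    for (r, s). *)
Lemma twist_relation g p q :
  Urel A d (t * r) (t * s) p q -> Th t g (p - q) \in I.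
Proof.
case=> [x y tx ty|i|i|i j|i j|i j|i j|i j|i j ij|i j ij].
- apply: (twist_rel (R1_comm A d r s tx ty)); first exact: twist_gen2.
  rewrite twist_gen2; apply: (congr1 ( *:%R^~ _)) => /=; congr (t ^ _).
  by case: x tx => // i _; case: y ty => // j _ /=; rewrite !add0r addrC.
- apply: (@twist_rel g 1 _ _ _ _ (R1_W A d r s i)); last by rewrite wtwist1 scale1r.
  rewrite twist_gen2 /= add0r; apply: (congr1 ( *:%R^~ _)) => /=.
  by rewrite -[RHS](expr0z t); congr (t ^ _); ring.
- apply: (@twist_rel g 1 _ _ _ _ (R1_W' A d r s i)); last by rewrite wtwist1 scale1r.
  rewrite twist_gen2 /= add0r; apply: (congr1 ( *:%R^~ _)) => /=.
  by rewrite -[RHS](expr0z t); congr (t ^ _); ring.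
- apply: (twist_rel (R2_W A d r s i j)); first exact: twist_gen3.
  rewrite wtwistZ wtwist_gen !scalerA; apply: (congr1 ( *:%R^~ _)) => /=.
  rewrite !expfzMl mulrACA -!expfzDr // mulrAC -expfzDr // mulrC [in RHS]mulrC.
  by congr (_ * t ^ _); rewrite !euler_formE; ring.
- apply: (twist_rel (R2_W' A d r s i j)); first exact: twist_gen3.
  rewrite wtwistZ wtwist_gen !scalerA; apply: (congr1 ( *:%R^~ _)) => /=.
  rewrite !expfzMl mulrACA -!expfzDr // mulrAC -expfzDr // mulrC [in RHS]mulrC.
  by congr (_ * t ^ _); rewrite !euler_formE; ring.
- apply: (twist_rel (R3_W A d r s i j)); first exact: twist_gen3.
  rewrite wtwistZ wtwist_gen !scalerA; apply: (congr1 ( *:%R^~ _)) => /=.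
  rewrite !expfzMl mulrACA -!expfzDr // mulrAC -expfzDr // mulrC [in RHS]mulrC.
  by congr (_ * t ^ _); rewrite !euler_formE; ring.
- apply: (twist_rel (R3_W' A d r s i j)); first exact: twist_gen3.
  rewrite wtwistZ wtwist_gen !scalerA; apply: (congr1 ( *:%R^~ _)) => /=.
  rewrite !expfzMl mulrACA -!expfzDr // mulrAC -expfzDr // mulrC [in RHS]mulrC.
  by congr (_ * t ^ _); rewrite !euler_formE; ring.
- pose e := euler_form A d g (simple_root i) - euler_form A d (simple_root j) g -
    euler A d j i.
  apply: (@twist_rel g (t ^ e) _ _ _ _ (R4 A d r s i j)).
    have eEF : N (GenE i) (Ugen_wt (GenF j) + g) + N (GenF j) g = e.
      by rewrite /= !euler_formE /e; ring.
    have eFE : N (GenF j) (Ugen_wt (GenE i) + g) + N (GenE i) g = e.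
      by rewrite /= !euler_formE /e; ring.
    rewrite raddfB /=.
    rewrite [X in X - _ = _]twist_gen2 [X in _ - X = _]twist_gen2.
    rewrite eEF eFE.
    exact: esym (scalerBr _ _ _).
  have ThW : Th t g (fgen K (GenW i) - fgen K (GenW' i)) =
      t ^ N (GenW i) g *: (fgen K (GenW i) - fgen K (GenW' i)).
    rewrite raddfB /= [X in X - _ = _]wtwist_gen [X in _ - X = _]wtwist_gen.
    exact: esym (scalerBr _ _ _).
  rewrite 2!wtwistZ ThW 2![in LHS]scalerA 2![in RHS]scalerA /=.
  (* For i = j the terms e_i f_i and f_i e_i get an extra factor t^-d_i, which *)
  (* turns 1 / (r_i - s_i) into the inverse of t^d_i (r_i - s_i).              *)
  have [ij|_] := eqVneq i j; last by rewrite !(mul0r, mulr0, scale0r).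
  apply: (congr1 ( *:%R^~ _)) => /=.
  rewrite !exprMn -mulrBr invfM exprnN /e -ij euler_diag [in RHS]expfzDr //.
  move: (t ^ _) (t ^ _) (_^-1) (_%:R) => x y z u; ring.
- pose c := t ^ (N (GenE i) (simple_root i) * 'C(serre_exp A i j, 2)%:Z
     + (serre_exp A i j)%:Z * N (GenE i) g + N (GenE j) g
     + (serre_exp A i j)%:Z * euler A d j i).
  apply: (@twist_rel g c _ _ _ _ (R5 A d r s ij)); last by rewrite raddf0 scaler0.
  apply: (@twist_serre (@GenE n) g i j _ (fun k => serre_exp A i j - k)%N id) => [k km|k km].
    by rewrite subnK.
  rewrite serre_coef_scale // mulrAC -expfzDr //.
  by congr (t ^ _ * _); rewrite /= !euler_formE -subzn //; ring.
- pose c := t ^ (N (GenF i) (- simple_root i) * 'C(serre_exp A i j, 2)%:Z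
     + (serre_exp A i j)%:Z * N (GenF i) g + N (GenF j) g
     + (serre_exp A i j)%:Z * euler A d j i).
  apply: (@twist_rel g c _ _ _ _ (R6 A d r s ij)); last by rewrite raddf0 scaler0.
  apply: (@twist_serre (@GenF n) g i j _ id (fun k => serre_exp A i j - k)%N) => [k km|k km].
    by rewrite subnKC.
  rewrite serre_coef_scale // mulrAC -expfzDr //.
  by congr (t ^ _ * _); rewrite /= !euler_formE -subzn //; ring.
Qed.

Lemma Uideal_twist g p :
  p \in Uideal A d (t * r) (t * s) -> Th t g p \in I.
Proof.
apply: (wtwist_ideal_gen t0) => [p' q'|g' p' q']; first exact: Urel_homog.
exact: twist_relation.
Qed.
End Twist.
End Transfer.

(** * Exchanging r and s *)

Section Swap.
Variables (K : fieldType) (n : nat) (A : 'M[int]_n) (d : 'I_n -> nat) (r s : K).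
Hypotheses (hA : finite_cartan_matrix A) (hd : symmetrizer A d).
Hypotheses (r0 : r != 0) (s0 : s != 0).
Implicit Types (i j : 'I_n) (g h : root_lattice n).
Local Notation F := (free_alg K (Ugen n)).

(** This is d_i a_ij, since the Serre exponent is 1 - a_ij; finite type enters
    through a_ij <= 0, and the symmetrizer through d_i a_ij = d_j a_ji. *)
Lemma euler_sym i j : i != j ->
  euler A d i j + euler A d j i = (d i)%:Z * (1 - (serre_exp A i j)%:Z).
Proof.
move=> ij; have [_ Ale _ _] := hA; have [_ dA _] := hd.
have -> : (serre_exp A i j)%:Z = 1 - A i j.
  by rewrite /serre_exp gez0_abs // subr_ge0 (le_trans (Ale _ _ ij)).
rewrite /euler -!val_eqE /= eq_sym opprB addrCA subrr addr0.
have [lij|lji|/val_inj eij] := ltngtP i j; rewrite ?addr0 ?add0r //.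
by rewrite eij eqxx in ij.
Qed.

(** Put v = r_i / s_i and m = 1 - a_ij.  Exchanging r and s replaces v by v^-1, and
    palindromicity costs a factor v^(- k (m - k)).  The total change in the power
    of v, namely k (m - k) + 2 'C(k, 2) = k (m - 1), is compensated by the change
    in the remaining powers of r and s, because v^(1 - m) = (r/s)^(d_i a_ij) and
    d_i a_ij is the symmetrized Euler form. *)
Lemma serre_coef_swap i j k : i != j -> (k <= serre_exp A i j)%N ->
  serre_coef A d s r i j k = serre_coef A d r s i j k.
Proof.
move=> ij km; rewrite /serre_coef; set m := serre_exp A i j in km *.
have v0 : r ^+ d i / s ^+ d i != 0 by rewrite mulf_neq0 ?invr_neq0 ?expf_neq0.
have -> : s ^+ d i / r ^+ d i = (r ^+ d i / s ^+ d i)^-1 by rewrite invf_div.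
rewrite qbinom_inv // exprVn; set v := r ^+ d i / s ^+ d i in v0 *.
rewrite -!mulrA; congr (_ * (_ * _)).
rewrite !mulrA -exprVn !exprnP !exprz_inv ?invr_expz.
have vE z : v ^ z = r ^ ((d i)%:Z * z) * s ^ (- ((d i)%:Z * z)).
  by rewrite /v expfzMl exprz_inv !exprnP !exprz_exp mulrN.
set x := k%:Z * euler A d i j; set y := k%:Z * euler A d j i.
have -> : v ^ (- (k * (m - k))%N%:Z) * v ^ (- 'C(k, 2)%:Z) =
    v ^ 'C(k, 2) * (r ^ (x + y) * s ^ (- (x + y))).
  have -> : x + y = - ((d i)%:Z * ((k * (m - k))%N%:Z + 2 * 'C(k, 2)%:Z)).
    rewrite -mulrDr euler_sym // -/m.
    have ->: (k * (m - k))%N%:Z = k%:Z * (m%:Z - 1) - 2 * 'C(k, 2)%:Z.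
      have k2 : (k * k = 2 * 'C(k, 2) + k)%N.
        by elim: (k) => // l IHl; rewrite binS bin1; lia.
      by rewrite mulnBr -subzn ?leq_mul2l ?km ?orbT // k2 PoszD !PoszM; ring.
    by ring.
  have -> : - - ((d i)%:Z * ((k * (m - k))%N%:Z + 2 * 'C(k, 2)%:Z)) =
     - ((d i)%:Z * - ((k * (m - k))%N%:Z + 2 * 'C(k, 2)%:Z)) by rewrite mulrN.
  rewrite -mulrN -vE -!expfzDr //; congr (v ^ _); ring.
rewrite opprD !expfzDr // -!invr_expz.
have := (expfz_neq0 x r0, expfz_neq0 y r0, expfz_neq0 x s0, expfz_neq0 y s0).
move: (r ^ x) (r ^ y) (s ^ x) (s ^ y) (v ^ _) => rx ry sx sy w [[[rx0 ry0] sx0] sy0].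
by field; rewrite rx0 sx0 sy0.
Qed.

(** With r and s exchanged, omega'_i acts on each e_j and f_j as omega_i did, and
    the right hand side of the relation for e_i f_i - f_i e_i is unchanged, its
    numerator and denominator both changing sign. *)
Definition Uswap (x : Ugen n) : Ugen n :=
  match x with
  | GenW i => GenW' i | GenWi i => GenW'i i
  | GenW' i => GenW i | GenW'i i => GenWi i
  | _ => x
  end.

Local Notation Sw := (wtwist (K := K) (@Ugen_wt n) Uswap 1 (fun _ _ => 0)).
Local Notation I := (Uideal A d s r).

Lemma swap_gen g x : Sw g (fgen K x) = fgen K (Uswap x).
Proof. by rewrite wtwist_gen exp1rz scale1r. Qed.

Lemma swap_gen2 g x y :
  Sw g (fgen K x * fgen K y) = fgen K (Uswap x) * fgen K (Uswap y).
Proof.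
by rewrite (wtwistM _ _ (oner_neq0 K) _ _ (homog_gen K (@Ugen_wt n) y)) !swap_gen.
Qed.

Lemma swap_gen3 g x y z :
  Sw g (fgen K x * fgen K y * fgen K z) =
  fgen K (Uswap x) * fgen K (Uswap y) * fgen K (Uswap z).
Proof.
by rewrite (wtwistM _ _ (oner_neq0 K) _ _ (homog_gen K (@Ugen_wt n) z)) swap_gen2 swap_gen.
Qed.

Lemma swap_rel g p q p' q' : Urel A d s r p' q' ->
  Sw g p = p' -> Sw g q = q' -> Sw g (p - q) \in I.
Proof. by move=> pq' pE qE; rewrite raddfB /= pE qE; exact: ideal_gen_rel. Qed.

Lemma swap_serre (x : 'I_n -> Ugen n) g i j (a b : nat -> nat) :
  (forall l, Uswap (x l) = x l) -> i != j ->
  Sw g (\sum_(0 <= k < (serre_exp A i j).+1) serre_coef A d r s i j k *: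
     (fgen K (x i) ^+ a k * fgen K (x j) * fgen K (x i) ^+ b k)) =
  \sum_(0 <= k < (serre_exp A i j).+1) serre_coef A d s r i j k *:
     (fgen K (x i) ^+ a k * fgen K (x j) * fgen K (x i) ^+ b k).
Proof.
move=> sx ij; rewrite raddf_sum /= !big_nat; apply: eq_bigr => k /andP[_ km].
rewrite ltnS in km; rewrite serre_coef_swap // wtwistZ; congr (_ *: _).
rewrite (wtwist_serre_monomial (@Ugen_wt n) Uswap (oner_neq0 K)) => [|x' g' h']; last first.
  by rewrite addr0.
by rewrite exp1rz scale1r !sx.
Qed.

Lemma swap_relation g p q : Urel A d r s p q -> Sw g (p - q) \in I.
Proof.
case=> [x y tx ty|i|i|i j|i j|i j|i j|i j|i j ij|i j ij].
- apply: (@swap_rel g _ _ _ _ (@R1_comm _ _ A d s r (Uswap x) (Uswap y) _ _)).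
  + by case: x tx.
  + by case: y ty.
  + exact: swap_gen2.
  + exact: swap_gen2.
- by apply: (swap_rel (R1_W' A d s r i)); [exact: swap_gen2|exact: wtwist1].
- by apply: (swap_rel (R1_W A d s r i)); [exact: swap_gen2|exact: wtwist1].
- apply: (swap_rel (R2_W' A d s r i j)); first exact: swap_gen3.
  by rewrite wtwistZ swap_gen mulrC.
- apply: (swap_rel (R2_W A d s r i j)); first exact: swap_gen3.
  by rewrite wtwistZ swap_gen mulrC.
- apply: (swap_rel (R3_W' A d s r i j)); first exact: swap_gen3.
  by rewrite wtwistZ swap_gen mulrC.
- apply: (swap_rel (R3_W A d s r i j)); first exact: swap_gen3.
  by rewrite wtwistZ swap_gen mulrC.
- apply: (swap_rel (R4 A d s r i j)).
    by rewrite raddfB /= [X in X - _ = _]swap_gen2 [X in _ - X = _]swap_gen2.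
  rewrite 2!wtwistZ; apply: (congr1 ( *:%R _)).
  rewrite raddfB /= [X in _ *: (X - _) = _]swap_gen [X in _ *: (_ - X) = _]swap_gen.
  rewrite -[s ^+ _ - _]opprB invrN scaleNr -scalerN opprB; reflexivity.
- apply: (swap_rel (R5 A d s r ij)); last exact: raddf0.
  exact: (@swap_serre (@GenE n)).
- apply: (swap_rel (R6 A d s r ij)); last exact: raddf0.
  exact: (@swap_serre (@GenF n) _ _ _ id).
Qed.

Lemma Uideal_swap g p : p \in Uideal A d r s -> Sw g p \in I.
Proof.
apply: (wtwist_ideal_gen (oner_neq0 K)) => [p' q'|g' p' q']; first exact: Urel_homog.
exact: swap_relation.
Qed.
End Swap.

(** * Words in the positive generators *)

Section EWords.
Variables (K : fieldType) (n : nat) (A : 'M[int]_n) (d : 'I_n -> nat).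
Implicit Types (i j : 'I_n) (w : seq 'I_n) (t : K).
Local Notation F := (free_alg K (Ugen n)).
Local Notation Th t := (wtwist (K := K) (@Ugen_wt n) id t (Ugen_exp A d) 0).
Local Notation Sw := (wtwist (K := K) (@Ugen_wt n) (@Uswap n) 1 (fun _ _ => 0) 0).

Definition eword w : F := \prod_(i <- w) fgen K (GenE i).

Definition epoly : {pred F} := Defs.span (fun p : F => exists w, p = eword w).

(** The exponent of t in the twist of the word e_i1 ... e_ik, that is, the sum of
    B(a_il, a_ij) over the positions j < l. *)
Fixpoint word_exp w : int :=
  if w is i :: w' then euler_form A d (wtE w') (simple_root i) + word_exp w' else 0.

Lemma wtE_cons i w : wtE (i :: w) = simple_root i + wtE w.
Proof. by rewrite /wtE big_cons. Qed.

Lemma wtE_cat w w' : wtE (w ++ w') = wtE w + wtE w'.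
Proof. by rewrite /wtE big_cat. Qed.

(** The defect of additivity is a bilinear function of the degrees, whence the
    cocycle of the theorem. *)
Lemma word_exp_cat w w' :
  word_exp (w ++ w') = word_exp w + word_exp w' + euler_form A d (wtE w') (wtE w).
Proof.
elim: w => [|i w IH] /=; first by rewrite /wtE big_nil euler_form0r addr0 add0r.
by rewrite IH wtE_cons wtE_cat !euler_formE; ring.
Qed.

Lemma homog_eword w : homog (@Ugen_wt n) (wtE w) (eword w).
Proof.
have := homog_prod K (@Ugen_wt n) [seq GenE i | i <- w].
by rewrite /wtm /eword !big_map.
Qed.

Lemma eword_cons i w : eword (i :: w) = fgen K (GenE i) * eword w.
Proof. by rewrite /eword big_cons. Qed.

Lemma twist_eword t w : t != 0 -> Th t (eword w) = t ^ word_exp w *: eword w.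
Proof.
move=> t0; elim: w => [|i w IH].
  by rewrite /eword big_nil wtwist1 scale1r.
rewrite eword_cons (wtwistM _ _ t0 _ _ (homog_eword w)) wtwist_gen IH scaleMM.
by apply: (congr1 ( *:%R^~ _)); rewrite /= addr0 -expfzDr.
Qed.

Lemma swap_eword w : Sw (eword w) = eword w.
Proof.
elim: w => [|i w IH]; first by rewrite /eword big_nil wtwist1.
rewrite eword_cons (wtwistM _ _ (oner_neq0 K) _ _ (homog_eword w)) wtwist_gen IH.
by rewrite exp1rz scale1r.
Qed.

Lemma epoly_lin c p q : p \in epoly -> q \in epoly -> c *: p + q \in epoly.
Proof. by case: (span_submod (fun p : F => exists w, p = eword w)) => _; apply. Qed.

Lemma epoly_eword w : eword w \in epoly.
Proof. by apply: span_mem; exists w. Qed.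

Lemma epoly_twist t p : t != 0 -> p \in epoly -> Th t p \in epoly.
Proof.
move=> t0; move: p; pose S : {pred F} := fun p => Th t p \in epoly.
have e0 : 0 \in epoly by case: (span_submod (fun p : F => exists w, p = eword w)).
apply: (span_ind (S := S)) => [|_ [w ->]].
  split=> [|c p q pS qS]; first by change (Th t 0 \in epoly); rewrite raddf0.
  have pS' : Th t p \in epoly := pS.
  have qS' : Th t q \in epoly := qS.
  have := epoly_lin c pS' qS'; rewrite -wtwist_lin => H; exact H.
change (Th t (eword w) \in epoly); rewrite twist_eword //.
by have := epoly_lin (t ^ word_exp w) (epoly_eword w) e0; rewrite addr0.
Qed.

Lemma swap_epoly p : p \in epoly -> Sw p = p.
Proof.
move=> pe; apply/eqP; move: p pe; pose S : {pred F} := fun p => Sw p == p.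
apply: (span_ind (S := S)) => [|_ [w ->]].
  split=> [|c p q /eqP pS /eqP qS]; first by rewrite unfold_in /S raddf0.
  by rewrite unfold_in /S wtwist_lin pS qS.
by rewrite unfold_in /S swap_eword.
Qed.

(** What it takes to send the positive part for (r, s) to the one for (r', s') by
    twisting words: relations that hold in the former become relations in the
    latter. *)
Definition transfers (t r s r' s' : K) := forall p, p \in epoly ->
  p \in Uideal A d r s -> Th t p \in Uideal A d r' s'.

Lemma transfers_scale t r s : t != 0 -> r != 0 -> s != 0 ->
  transfers t (t * r) (t * s) r s.
Proof. by move=> t0 r0 s0 p _; apply: Uideal_twist. Qed.

Lemma transfers_swap t r s : finite_cartan_matrix A -> symmetrizer A d ->
  t != 0 -> r != 0 -> s != 0 -> transfers t (t * s) (t * r) r s.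
Proof.
move=> hA hd t0 r0 s0 p pe pI; rewrite -(swap_epoly (epoly_twist t0 pe)).
by apply: Uideal_swap => //; apply: Uideal_twist.
Qed.

End EWords.

(** * The induced map of positive parts *)

Section LinearMap.
Variables (K : fieldType) (n : nat) (A : 'M[int]_n) (d : 'I_n -> nat).
Variables (t r s r' s' : K).
Hypotheses (t0 : t != 0) (tr : transfers A d t r s r' s').
Local Notation F := (free_alg K (Ugen n)).
Local Notation Th := (wtwist (K := K) (@Ugen_wt n) id t (Ugen_exp A d) 0).

Lemma Upos_lift q q' (x : Upos A d q q') :
  exists2 p : F, p \in @epoly K n & val x = Upi A d q q' p.
Proof.
pose S : {pred Upos A d q q'} :=
  fun x => `[< exists2 p : F, p \in @epoly K n & val x = Upi A d q q' p >].
suff : x \in S by move/asboolP.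
apply: (span_ind _ _ (Upos_span x)) => [|_ [w ->]]; last first.
  apply/asboolP; exists (@eword K n w); last exact: Upos_monE.
  exact: epoly_eword.
split.
  apply/asboolP; exists 0; first by case: (span_submod (fun p : F => exists w, p = @eword K n w)).
  exact: etrans (raddf0 _) (esym (raddf0 _)).
move=> c u v /asboolP[p pe up] /asboolP[q1 qe vq]; apply/asboolP.
exists (c *: p + q1); first exact: epoly_lin.
apply: etrans (linearP (val : Upos A d q q' -> U A d q q') c u v) _.
exact: etrans (congr2 (fun a b : U A d q q' => c *: a + b) up vq)
  (esym (linearP (Upi A d q q') c p q1)).
Qed.

Lemma epoly_Upos q q' (p : F) : p \in @epoly K n ->
  exists x : Upos A d q q', val x = Upi A d q q' p.
Proof.
pose S : {pred F} := fun p => `[< exists x : Upos A d q q', val x = Upi A d q q' p >].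
move=> pe; suff : p \in S by move/asboolP.
move: p pe; apply: (span_ind (S := S)) => [|_ [w ->]]; last first.
  by apply/asboolP; exists (Upos_mon A d q q' w); exact: Upos_monE.
split.
  by apply/asboolP; exists 0; exact: etrans (raddf0 _) (esym (raddf0 _)).
move=> c p p' /asboolP[x xp] /asboolP[x' xp']; apply/asboolP.
exists (c *: x + x').
apply: etrans (linearP (val : Upos A d q q' -> U A d q q') c x x') _.
exact: etrans (congr2 (fun a b : U A d q q' => c *: a + b) xp xp')
  (esym (linearP (Upi A d q q') c p p')).
Qed.

(** Lift to the span of the words in the e_i, twist, and project.  Two lifts of the
    same element differ by an element of I(r, s), which the twist sends to
    I(r', s'); so the result does not depend on the lift. *)
Lemma Upos_linear_map : exists2 f : Upos A d r s -> Upos A d r' s',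
  (forall c x y, f (c *: x + y) = c *: f x + f y) &
  (forall w, f (Upos_mon A d r s w) = t ^ word_exp A d w *: Upos_mon A d r' s' w).
Proof.
have ex (x : Upos A d r s) : exists y : Upos A d r' s', forall p : F, p \in @epoly K n ->
    val x = Upi A d r s p -> val y = Upi A d r' s' (Th p).
  have [p0 pe0 xp0] := Upos_lift x.
  have [y yp0] := epoly_Upos r' s' (epoly_twist A d t0 pe0).
  exists y => p pe xp; rewrite yp0; apply/quot_piP.
  rewrite -raddfB; apply: tr.
    by rewrite -[p0 - p]addrC -scaleN1r epoly_lin.
  by apply/quot_piP; rewrite -[LHS]xp0 -[RHS]xp.
pose f x := sval (cid (ex x)); have fP x := svalP (cid (ex x)).
exists f => [c x y|w].
  have [p pe xp] := Upos_lift x; have [q qe yq] := Upos_lift y.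
  apply: val_inj.
  rewrite (fP (c *: x + y) (c *: p + q) (epoly_lin c pe qe)); last first.
    apply: etrans (linearP (val : Upos A d r s -> U A d r s) c x y) _.
    exact: etrans (congr2 (fun a b : U A d r s => c *: a + b) xp yq)
      (esym (linearP (Upi A d r s) c p q)).
  apply: esym; apply: etrans (linearP (val : Upos A d r' s' -> U A d r' s') c _ _) _.
  apply: etrans (congr2 (fun a b : U A d r' s' => c *: a + b) (fP x p pe xp) (fP y q qe yq)) _.
  by rewrite wtwist_lin; exact: esym (linearP (Upi A d r' s') c _ _).
apply: val_inj; rewrite (fP _ (@eword K n w)); last 2 first.
- exact: epoly_eword.
- exact: Upos_monE.
rewrite (twist_eword A d w t0).
apply: etrans (linearZ_LR (Upi A d r' s') _ _) _.
apply: etrans (congr1 ( *:%R _) (esym (Upos_monE A d r' s' w))) _.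
exact: esym (linearZ_LR (val : Upos A d r' s' -> U A d r' s') _ _).
Qed.
End LinearMap.

(** * Cocycle twists and maps that scale monomials *)

Section EulerCocycle.
Variables (K : fieldType) (n : nat) (A : 'M[int]_n) (d : 'I_n -> nat) (t : K).
Hypothesis t0 : t != 0.

Definition euler_bichar (g h : root_lattice n) : K := t ^ (- euler_form A d h g).

Lemma euler_bichar_neq0 g h : euler_bichar g h != 0.
Proof. exact: expfz_neq0. Qed.

Lemma euler_bichar_cocycle g h k :
  euler_bichar g h * euler_bichar (g + h) k =
  euler_bichar g (h + k) * euler_bichar h k.
Proof.
by rewrite /euler_bichar -!expfzDr //; congr (t ^ _); rewrite !euler_formE; ring.
Qed.

Definition euler_cocycle : cocycle K (root_lattice n) :=
  Cocycle euler_bichar_neq0 euler_bichar_cocycle.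

End EulerCocycle.

Section LinearOnSpan.
Variables (K : fieldType) (A B : algType K) (f : A -> B).
Hypothesis fL : forall c x y, f (c *: x + y) = c *: f x + f y.

Lemma lin_map0 : f 0 = 0.
Proof. by have := fL (-1) 0 0; rewrite scaler0 addr0 scaleN1r addNr. Qed.

Lemma lin_mapZ c x : f (c *: x) = c *: f x.
Proof. by rewrite -[c *: x]addr0 fL lin_map0 addr0. Qed.

Lemma lin_map_span (P : A -> Prop) (S : {pred B}) : submod_closed S ->
  (forall x, P x -> f x \in S) -> forall x, x \in Defs.span P -> f x \in S.
Proof.
move=> [S0 SL] PS; pose S' : {pred A} := fun x => f x \in S.
apply: (span_ind (S := S')) => [|x Px]; last exact: PS.
split=> [|c u v uS vS]; rewrite unfold_in /S'; first by rewrite lin_map0.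
by rewrite fL; exact: SL.
Qed.

End LinearOnSpan.

Lemma lin_map_eq (K : fieldType) (A B : algType K) (f g : A -> B) (P : A -> Prop) :
  (forall c x y, f (c *: x + y) = c *: f x + f y) ->
  (forall c x y, g (c *: x + y) = c *: g x + g y) ->
  (forall x, P x -> f x = g x) -> forall x, x \in Defs.span P -> f x = g x.
Proof.
move=> fL gL fg x xP; apply/eqP; move: x xP; pose S : {pred A} := fun x => f x == g x.
apply: (span_ind (S := S)) => [|x /fg fgx]; last exact/eqP.
split=> [|c u v /eqP uS /eqP vS]; apply/eqP; first by rewrite !lin_map0.
by rewrite fL gL uS vS.
Qed.

(** Two graded algebras are spanned by monomials mA w and mB w indexed by the same
    words.  Linear maps f and g that match the monomials up to the scalars a w form
    an isomorphism from the twist of A by psi onto B, provided that psi measures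
    the failure of the scalars to be multiplicative. *)
Section MonomialTwist.
Variables (K : fieldType) (G : zmodType) (T : Type) (A B : algType K).
Variables (gA : grading G A) (gB : grading G B) (psi : cocycle K G).
Variables (wt : seq T -> G) (mA : seq T -> A) (mB : seq T -> B) (a : seq T -> K).
Variables (f : A -> B) (g : B -> A).
Hypotheses (wt_cat : forall w w', wt (w ++ w') = wt w + wt w').
Hypotheses (mA1 : mA [::] = 1) (mA_cat : forall w w', mA (w ++ w') = mA w * mA w').
Hypotheses (mB1 : mB [::] = 1) (mB_cat : forall w w', mB (w ++ w') = mB w * mB w').
Hypothesis gA_span : forall b x,
  x \in gA b -> x \in Defs.span (fun x => exists2 w, wt w = b & x = mA w).
Hypothesis gB_span : forall b x,
  x \in gB b -> x \in Defs.span (fun x => exists2 w, wt w = b & x = mB w).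
Hypotheses (gA_mon : forall w, mA w \in gA (wt w)).
Hypotheses (gB_mon : forall w, mB w \in gB (wt w)).
Hypotheses (spanA : forall x, x \in Defs.span (fun x => exists w, x = mA w)).
Hypotheses (spanB : forall x, x \in Defs.span (fun x => exists w, x = mB w)).
Hypotheses (a0 : forall w, a w != 0).
Hypotheses (a_cat : forall w w', psi (wt w) (wt w') * a (w ++ w') = a w * a w').
Hypotheses (fL : forall c x y, f (c *: x + y) = c *: f x + f y).
Hypotheses (gL : forall c x y, g (c *: x + y) = c *: g x + g y).
Hypotheses (fE : forall w, f (mA w) = a w *: mB w).
Hypotheses (gE : forall w, g (mB w) = (a w)^-1 *: mA w).

Lemma monomial_mapK : cancel f g.
Proof.
move=> x; apply: (lin_map_eq (f := g \o f) (g := id) _ _ _ (spanA x)) => //=.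
  by move=> c u v; rewrite fL gL.
by move=> _ [w ->]; rewrite fE (lin_mapZ gL) gE scalerA divff ?scale1r.
Qed.

Lemma monomial_mapVK : cancel g f.
Proof.
move=> x; apply: (lin_map_eq (f := f \o g) (g := id) _ _ _ (spanB x)) => //=.
  by move=> c u v; rewrite gL fL.
by move=> _ [w ->]; rewrite gE (lin_mapZ fL) fE scalerA mulVf ?scale1r.
Qed.

Lemma monomial_map_gcomp b x : x \in gA b -> f x \in gB b.
Proof.
move=> /gA_span; apply: (lin_map_span fL); first exact: gcomp_submod.
by move=> _ [w <- ->]; rewrite fE; apply: gcompZ.
Qed.

Lemma monomial_mapV_gcomp b y : y \in gB b -> g y \in gA b.
Proof.
move=> /gB_span; apply: (lin_map_span gL); first exact: gcomp_submod.
by move=> _ [w <- ->]; rewrite gE; apply: gcompZ.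
Qed.

Lemma monomial_map_twist x y : f (twist_mul gA psi x y) = f x * f y.
Proof.
apply: (lin_map_eq (f := fun x => f (twist_mul gA psi x y))
                   (g := fun x => f x * f y) _ _ _ (spanA x)).
- by move=> c u v; rewrite twist_mul_linl fL.
- by move=> c u v; rewrite fL mulrDl scalerAl.
move=> _ [w ->].
apply: (lin_map_eq (f := fun y => f (twist_mul gA psi (mA w) y))
                   (g := fun y => f (mA w) * f y) _ _ _ (spanA y)).
- by move=> c u v; rewrite twist_mul_linr fL.
- by move=> c u v; rewrite fL mulrDr scalerAr.
move=> _ [w' ->]; rewrite (twist_mul_homog psi (gA_mon w) (gA_mon w')) -mA_cat.
by rewrite (lin_mapZ fL) !fE mB_cat -scalerAl -scalerAr !scalerA a_cat.
Qed.

(** The unit of the twist is (psi 0 0)^-1 times the unit of A, and a_cat on the empty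
    word forces a [::] = psi 0 0. *)
Lemma monomial_map_twist1 : f (twist_one A psi) = 1.
Proof.
have wt0 : wt [::] = 0 by apply: (addrI (wt [::])); rewrite -wt_cat addr0.
rewrite /twist_one (lin_mapZ fL) -mA1 fE mB1 scalerA.
have /(mulIf (a0 [::])) <- := a_cat [::] [::].
by rewrite wt0 mulVf ?cocycle_neq0 // scale1r.
Qed.

Lemma monomial_map_graded_iso : graded_iso (twist_grading gA psi) gB.
Proof.
have fB : zmod_morphism (f : twist gA psi -> B).
  by move=> x y; rewrite addrC -scaleN1r fL scaleN1r addrC.
have fM : monoid_morphism (f : twist gA psi -> B).
  by split=> [|x y]; [exact: monomial_map_twist1|exact: monomial_map_twist].
have fZ : scalable (f : twist gA psi -> B) by move=> c x; exact: lin_mapZ.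
pose fa := GRing.isZmodMorphism.Build (twist gA psi) B f fB.
pose fm := GRing.isMonoidMorphism.Build (twist gA psi) B f fM.
pose fs := GRing.isScalable.Build K (twist gA psi) B *:%R f fZ.
pose phi : {lrmorphism twist gA psi -> B} := HB.pack f fa fm fs.
exists phi; first by exists g; [exact: monomial_mapK|exact: monomial_mapVK].
move=> b x; apply/idP/idP => [fx|xb]; last exact: monomial_map_gcomp.
by have := monomial_mapV_gcomp fx; rewrite /= monomial_mapK.
Qed.
End MonomialTwist.

(** * The isomorphisms of positive parts *)

Lemma Upos_twist_iso (K : fieldType) (n : nat) (A : 'M[int]_n) (d : 'I_n -> nat)
    (t r s r' s' : K) (t0 : t != 0) :
  transfers A d t r s r' s' -> transfers A d t^-1 r' s' r s ->
  graded_iso (twist_grading (Upos_grading A d r s) (euler_cocycle A d t0))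
             (Upos_grading A d r' s').
Proof.
move=> tr tr'; have [f fL fw] := Upos_linear_map t0 tr.
have t'0 : t^-1 != 0 by rewrite invr_neq0.
have [g gL gw] := Upos_linear_map t'0 tr'.
have mon1 q q' : Upos_mon A d q q' [::] = 1 by rewrite /Upos_mon big_nil.
have mon_cat q q' w w' :
    Upos_mon A d q q' (w ++ w') = Upos_mon A d q q' w * Upos_mon A d q q' w'.
  by rewrite /Upos_mon big_cat.
have mon_gr q q' w : Upos_mon A d q q' w \in Upos_grading A d q q' (wtE w).
  by apply: span_mem; exists w.
apply: (@monomial_map_graded_iso K (root_lattice n) 'I_n _ _ _ _ _ (@wtE n)
  (Upos_mon A d r s) (Upos_mon A d r' s') (fun w => t ^ word_exp A d w) f g) => //.
- exact: wtE_cat.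
- exact: Upos_span.
- exact: Upos_span.
- by move=> w; apply: expfz_neq0.
- move=> w w'; rewrite /= /euler_bichar word_exp_cat -!expfzDr //.
  by congr (t ^ _); ring.
- by move=> w; rewrite gw exprz_inv invr_expz.
Qed.

(** The scalar t is r / r' in the first case and r / s' in the second one. *)
Lemma Upos_is_twist (K : fieldType) (n : nat) (A : 'M[int]_n) (d : 'I_n -> nat)
    (r s r' s' : K) :
  finite_cartan_matrix A -> symmetrizer A d ->
  r != 0 -> s != 0 -> r' != 0 -> s' != 0 ->
  r * s^-1 = r' * s'^-1 \/ r * s^-1 = r'^-1 * s' ->
  exists psi : cocycle K (root_lattice n),
    graded_iso (twist_grading (Upos_grading A d r s) psi) (Upos_grading A d r' s').
Proof.
move=> hA hd r0 s0 r'0 s'0 [e|e].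
  pose t := r / r'; have t0 : t != 0 by rewrite mulf_neq0 ?invr_neq0.
  have rE : r = t * r' by rewrite /t divfK.
  have sE : s = t * s'.
    by apply/invr_inj/(mulfI r0); rewrite e /t; field; rewrite r0 r'0 s'0.
  exists (euler_cocycle A d t0); apply: Upos_twist_iso.
    by have := @transfers_scale K n A d _ _ _ t0 r'0 s'0; rewrite -rE -sE.
  have t'0 : t^-1 != 0 by rewrite invr_neq0.
  by have := @transfers_scale K n A d _ _ _ t'0 r0 s0; rewrite {1}rE {1}sE !mulKf.
pose t := r / s'; have t0 : t != 0 by rewrite mulf_neq0 ?invr_neq0.
have rE : r = t * s' by rewrite /t divfK.
have sE : s = t * r'.
  by apply/invr_inj/(mulfI r0); rewrite e /t; field; rewrite r0 r'0 s'0.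
exists (euler_cocycle A d t0); apply: Upos_twist_iso.
  by have := transfers_swap hA hd t0 r'0 s'0; rewrite -rE -sE.
have t'0 : t^-1 != 0 by rewrite invr_neq0.
by have := transfers_swap hA hd t'0 r0 s0; rewrite {1}rE {1}sE !mulKf.
Qed.

Theorem theorem3p2 (R : realType) (n : nat) (A : 'M[int]_n) (d : 'I_n -> nat)
  (r s r' s' : R[i])
  (hA : finite_cartan_matrix A) (hd : symmetrizer A d)
  (hr : r != 0) (hs : s != 0) (hr' : r' != 0) (hs' : s' != 0)
  (hrs : forall i, r ^+ d i != s ^+ d i)
  (hrs' : forall i, r' ^+ d i != s' ^+ d i)
  (hq : r * s^-1 = r' * s'^-1 \/ r * s^-1 = r'^-1 * s') :
  exists psi psi' : cocycle R[i] (root_lattice n),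
    graded_iso (twist_grading (Upos_grading A d r s) psi)
               (Upos_grading A d r' s')
    /\
    graded_iso (twist_grading (Upos_grading A d r' s') psi')
               (Upos_grading A d r s).
Proof.
have hq' : r' * s'^-1 = r * s^-1 \/ r' * s'^-1 = r^-1 * s.
  case: hq => e; [by left|right].
  by rewrite -[RHS]invrK invfM invrK e invfM invrK.
have [[psi iso] [psi' iso']] := (Upos_is_twist hA hd hr hs hr' hs' hq,
  Upos_is_twist hA hd hr' hs' hr hs hq').
by exists psi, psi'.
Qed.
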